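(* Let $\mathscr B$ and $X_\eta$ be as in the context. For every ergodic $S$-invariant Borel probability measure $\nu$ on $X_\eta$ there exist a set $\mathscr B'=\{b'_1,b'_2,\dots\}\subset\{2,3,\dots\}$ with pairwise coprime elements and $\sum_k 1/b'_k<\infty$, such that the corresponding $\mathscr B'$-free subshift satisfies $X_{\eta'}\subset X_\eta$, and an ergodic $S\times S$-invariant probability measure $\widetilde\rho$ on $X_\eta\times\{0,1\}^{\mathbb Z}$ whose projection to the first coordinate is the Mirsky measure $\nu_{\mathscr B'}$ and such that $M_*(\widetilde\rho)=\nu$.
   Context: Let $S$ be the shift on $\{0,1\}^{\mathbb Z}$, $(Sx)(n)=x(n+1)$. For a set $\mathscr{B}=\{b_1,b_2,\dots\}\subset\{2,3,\dots\}$ with $\gcd(b_i,b_j)=1$ for $i\ne j$ and $\sum_i1/b_i<\infty$, define $\eta\in\{0,1\}^{\mathbb Z}$ by $\eta(n)=1$ iff $b_i\nmid n$ for all $i$, and let $X_\eta$ (the $\mathscr B$-free subshift) be the set of $y\in\{0,1\}^{\mathbb Z}$ all of whose finite blocks occur in $\eta$; equivalently $y\in X_\eta$ iff $|\mathrm{supp}(y)\bmod b_i|<b_i$ for all $i$, where $\mathrm{supp}(y)=\{n:y(n)=1\}$. Let $\Omega=\prod_i\mathbb Z/b_i\mathbb Z$ with normalized Haar measure $\mathbb P$, and $\varphi:\Omega\to\{0,1\}^{\mathbb Z}$, $\varphi(\omega)(n)=1$ iff $\omega(i)+n\not\equiv0\pmod{b_i}$ for all $i$. The Mirsky measure of $\mathscr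 B$ is $\nu_{\mathscr B}=\varphi_*\mathbb P$, an $S$-invariant measure on $X_\eta$; $\eta'$, $X_{\eta'}$, $\nu_{\mathscr B'}$ denote the analogous objects for $\mathscr B'$. The map $M:X_\eta\times\{0,1\}^{\mathbb Z}\to X_\eta$ is $M(x,u)(n)=x(n)u(n)$. *)

(* Defs.v *)
From HB Require Import structures.
From mathcomp Require Import all_boot all_order all_algebra.
From mathcomp Require Import all_classical all_reals all_analysis.
Set Implicit Arguments. Unset Strict Implicit. Unset Printing Implicit Defensive.
Import Order.TTheory GRing.Theory Num.Theory.
Local Open Scope classical_set_scope.
Local Open Scope ring_scope.

(* Cylinder generators on I -> T: preimages of points under coordinate maps.
   For countable I and discrete countable T (here T = bool or nat) the generated
   sigma-algebra is the Borel sigma-algebra of the product topology. *)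
Definition cyl_gen (I T : Type) : set (set (I -> T)) :=
  [set A | exists (i : I) (t : T), A = (fun x => x i) @^-1` [set t]].
Arguments cyl_gen : clear implicits.

Definition seqZ := g_sigma_algebraType (cyl_gen int bool).
(* ambient space for Omega = prod_{b in B} Z/bZ : functions nat -> nat,
   coordinate b holding the residue omega(b) in Z/bZ. *)
Definition seqN := g_sigma_algebraType (cyl_gen nat nat).

Definition Sshift (x : seqZ) : seqZ := fun n => x (n + 1)%R.
Definition Sshift2 (p : seqZ * seqZ) : seqZ * seqZ := (Sshift p.1, Sshift p.2).

Definition Mmap (p : seqZ * seqZ) : seqZ := fun n => p.1 n && p.2 n.

Definition invariant {d} {T : measurableType d} {R : realType}
  (f : T -> T) (mu : set T -> \bar R) :=
  forall A : set T, measurable A -> mu (f @^-1` A) = mu A.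

Definition ergodic {d} {T : measurableType d} {R : realType}
  (f : T -> T) (mu : set T -> \bar R) :=
  invariant f mu /\
  forall A : set T, measurable A -> f @^-1` A = A -> mu A = 0%E \/ mu A = 1%E.

Definition Bfree_basis (R : realType) (B : set nat) :=
  [/\ (forall b, B b -> (2 <= b)%N),
      (forall b c, B b -> B c -> b <> c -> coprime b c) &
      (\sum_(b <oo | b \in B) ((b%:R : R)^-1)%:E < +oo)%E].

Definition eta (B : set nat) (n : int) : bool :=
  `[< forall b, B b -> ~ (b%:Z %| n)%Z >].

Definition Xeta (B : set nat) : set seqZ :=
  [set y | forall (m : int) (len : nat), exists k : int,
     forall j : nat, (j < len)%N -> y (m + j%:Z) = eta B (k + j%:Z)].

(* Omega_B = prod_{b in B} Z/bZ, realised inside nat -> nat *)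
Definition OmegaSet (B : set nat) : set seqN :=
  [set w | forall b, (B b -> (w b < b)%N) /\ (~ B b -> w b = 0%N)].

Definition transl (B : set nat) (w : seqN) (x : seqN) : seqN :=
  fun b => if `[< B b >] then ((x b + w b) %% b)%N else 0%N.

Definition phi (B : set nat) (w : seqN) : seqZ :=
  fun n => `[< forall b, B b -> ~ (b%:Z %| (w b)%:Z + n)%Z >].

Definition haar_Omega (R : realType) (B : set nat) (P : probability seqN R) :=
  P.-negligible (~` OmegaSet B) /\
  forall w, OmegaSet B w -> invariant (transl B w) P.

Definition mirsky (R : realType) (B : set nat) (mu : set seqZ -> \bar R) :=
  exists P : probability seqN R, haar_Omega B P /\
    forall A : set seqZ, measurable A -> mu A = pushforward P (phi B) A.

(* Main.v *)
(* Let d_b divide b be the size of the orbit, under rotation of Z/b, of the set of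
   residue classes mod b missed by supp(y); by ergodicity this orbit is the same
   for nu-almost every y.  The position of y in the orbit is a map
   theta_b : y -> Z/d_b with theta_b(Sy) = theta_b(y) + 1, and y vanishes on
   -theta_b(y) + d_b Z.  Put B' = {d_b}.  A measure on Omega' invariant under
   w -> w + 1 must be Haar, as the coordinates are independent by coprimality, and
   it is ergodic; so theta_* nu is Haar and rho is the law of (phi(theta(y)), y).
   If nu{y(0) = 1} = c > 0, then prod (1 - 1/d_b) >= c, so sum 1/d_b converges.
   Otherwise nu is the point mass at 0, and rho is Mirsky times nu with B' = B, the
   Haar measure being the law of the Cantor-series digits of a uniform point of
   [0, 1).
   The inclusion of X_{eta'} in X_eta needs every B-admissible block to occur in
   eta: its zeros are prescribed by congruences to finitely many b, and a counting
   sieve in the resulting arithmetic progression avoids the remaining b.  For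
   finite B this fails, but then exactly one class mod b is missed and B' = B. *)
Require Import Defs.
From HB Require Import structures.
From mathcomp Require Import all_boot all_order all_algebra.
From mathcomp Require Import all_classical all_reals all_analysis.
From mathcomp Require Import ring lra zify.
Import Order.TTheory GRing.Theory Num.Theory.
Local Open Scope classical_set_scope.
Local Open Scope ring_scope.

(** * Invariant measures, null sets and equidistribution of residues *)

Lemma invariant_iter {d} {T : measurableType d} {R : realType} (f : T -> T)
    (P : probability T R) (n : nat) :
  measurable_fun setT f -> Defs.invariant f P ->
  measurable_fun setT (iter n f) /\ Defs.invariant (iter n f) P.
Proof.
move=> mf invf; elim: n => [|n [IHm IHi]].
  by split; [exact: measurable_id|move=> A mA].
split; first exact: (measurableT_comp mf IHm).
move=> A mA /=.
rewrite -(invf A mA) -(IHi (f @^-1` A))//.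
by rewrite -[X in measurable X]setTI; exact: mf.
Qed.

Lemma eq_measure_off_negligible {d} {T : measurableType d} {R : realType}
    (P : probability T R) (N X Y : set T) :
  P.-negligible N -> measurable X -> measurable Y ->
  (forall x, ~ N x -> X x <-> Y x) -> P X = P Y.
Proof.
move=> [M [mM PM0 NM]] mX mY XY.
have PD Z : measurable Z -> P Z = P (Z `\` M).
  move=> mZ; rewrite (measureDI P mZ mM) (@subset_measure0 _ _ _ _ (Z `&` M) M)//.
  - by rewrite adde0.
  - exact: measurableI.
rewrite (PD X mX) (PD Y mY); congr (P _); apply/seteqP.
by split=> x [Zx nMx]; split=> //; apply/XY => // /NM.
Qed.

Lemma measure_fiber_sum {d} {T : measurableType d} {R : realType}
    (P : probability T R) (E : set T) (b : nat) (th : T -> nat) (A : pred nat) :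
  measurable E -> (forall r, measurable (th @^-1` [set r])) ->
  (forall x, (th x < b)%N) ->
  P (E `&` [set x | A (th x)]) =
    (\sum_(r < b | A r) P (E `&` th @^-1` [set (r : nat)]))%E.
Proof.
move=> mE mth thb.
rewrite -measure_bigsetU_ord; first last.
- apply/trivIsetP => i j _ _ /eqP ij; apply/seteqP; split=> x //= [[_ xi] [_ xj]].
  by apply: ij; apply: val_inj; rewrite /= -xi -xj.
- by move=> i; exact: measurableI.
rewrite big_mkcond -(bigcup_mkord b (fun r => if A r then _ `&` _ @^-1` [set r] else _)).
congr (P _); apply/seteqP; split=> x /=.
  by move=> [Ex Ax]; exists (th x); [exact: thb|rewrite Ax].
by move=> [r _]; case: ifP => // Ar [Ex /= ->].
Qed.

Lemma chinese_multiple (N b r : nat) :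
  coprime N b -> exists j, (N * j = r %[mod b])%N.
Proof.
move=> co; have /dvdnP[q Hq] : (N %| chinese N b 0 r)%N.
  by rewrite /dvdn chinese_modl// mod0n.
by exists q; rewrite mulnC -Hq chinese_modr.
Qed.

(* Translating by a multiple of [N] in time preserves [E] but moves any residue
   class of [th] to any other. *)
Lemma equivariant_residue_indep {d} {T : measurableType d} {R : realType}
    (P : probability T R) (f : T -> T) (E : set T) (N b : nat) (th : T -> nat) :
  measurable_fun setT f -> Defs.invariant f P ->
  measurable E -> iter N f @^-1` E = E ->
  coprime N b -> (forall r, measurable (th @^-1` [set r])) ->
  (forall x, (th x < b)%N) -> (forall x, th (f x) = (th x + 1) %% b)%N ->
  forall r, (r < b)%N ->
  P (E `&` th @^-1` [set r]) = (P E * (b%:R^-1)%:E)%E.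
Proof.
move=> mf invf mE EN co mth thb thf.
have thit n x : (th (iter n f x) = (th x + n) %% b)%N.
  elim: n => [|n IH]; first by rewrite addn0 modn_small.
  by rewrite iterS thf IH modnDml addn1 addnS.
have EiterN j : iter (N * j) f @^-1` E = E.
  elim: j => [|j IH]; first by rewrite muln0.
  rewrite mulnS -[RHS]EN -[in RHS]IH; apply/seteqP.
  by split=> x; rewrite /preimage/= addnC iterD.
have const r : (r < b)%N -> P (E `&` th @^-1` [set r]) = P (E `&` th @^-1` [set 0%N]).
  move=> rb; have [j Hj] := chinese_multiple N b r co.
  have [_ inv] := invariant_iter f P (N * j) mf invf.
  rewrite -inv; last exact: measurableI.
  rewrite preimage_setI EiterN; congr (P (E `&` _)).
  apply/seteqP; split=> x; rewrite /preimage/= thit -modnDmr Hj modnDmr.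
    move=> h; have /eqP : (th x + r = 0 + r %[mod b])%N by rewrite h add0n modn_small.
    by rewrite eqn_modDr mod0n modn_small// => /eqP.
  by move=> ->; rewrite add0n modn_small.
(* The b fibres partition [E] and all have the mass of the fibre over 0. *)
have PE : P E = (\sum_(r < b) P (E `&` th @^-1` [set (r : nat)]))%E.
  rewrite -(measure_fiber_sum P E b th predT)//; congr (P _).
  by apply/seteqP; split=> x // [].
move=> r rb; rewrite (const r rb).
have -> : P E = (\sum_(r < b) P (E `&` th @^-1` [set 0%N]))%E.
  by rewrite PE; apply: eq_bigr => i _; rewrite const.
have mE0 : measurable (E `&` th @^-1` [set 0%N]) by exact: measurableI.
rewrite -(fineK (fin_num_measure P _ mE0)) sumEFin -EFinM; congr (_%:E).
rewrite sumr_const card_ord -[X in X / _]mulr_natr mulfK// pnatr_eq0.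
by rewrite -lt0n; case: (b) rb.
Qed.

(** * Cylinders and measurability in the sequence spaces *)

Definition cylinder (n : nat) (A : nat -> pred nat) : set seqN :=
  [set x | forall i, (i < n)%N -> A i (x i)].

Lemma measurable_coord {I T : Type} (i : I) (t : T) :
  <<s cyl_gen I T >> ((fun x : I -> T => x i) @^-1` [set t]).
Proof. by apply: sub_sigma_algebra; exists i, t. Qed.

Lemma measurable_coordN (i : nat) (A : set nat) :
  measurable ((fun x : seqN => x i) @^-1` A).
Proof.
have -> : (fun x : seqN => x i) @^-1` A =
    \bigcup_(t in A) ((fun x : seqN => x i) @^-1` [set t]).
  by apply/seteqP; split=> x /=; [move=> ?; exists (x i)|move=> [t At ->]].
by apply: bigcup_measurable => t _; exact: measurable_coord.
Qed.

Lemma measurable_coordZ (i : int) (A : set bool) :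
  measurable ((fun x : seqZ => x i) @^-1` A).
Proof.
have -> : (fun x : seqZ => x i) @^-1` A =
    \bigcup_(t in A) ((fun x : seqZ => x i) @^-1` [set t]).
  by apply/seteqP; split=> x /=; [move=> ?; exists (x i)|move=> [t At ->]].
by apply: fin_bigcup_measurable => // t _; exact: measurable_coord.
Qed.

Lemma measurable_fun_seqN {d} {X : measurableType d} (f : X -> seqN) :
  (forall i r, measurable [set x | f x i = r]) -> measurable_fun setT f.
Proof.
move=> mf; apply: (@measurability _ _ X seqN setT f (cyl_gen nat nat)) => //.
by move=> _ [_ [i [t ->]] <-]; rewrite setTI; exact: mf.
Qed.

Lemma measurable_fun_seqZ {d} {X : measurableType d} (f : X -> seqZ) :
  (forall i, measurable [set x | f x i]) -> measurable_fun setT f.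
Proof.
move=> mf; apply: (@measurability _ _ X seqZ setT f (cyl_gen int bool)) => //.
move=> _ [_ [i [t ->]] <-]; rewrite setTI; case: t; first exact: mf.
rewrite (_ : _ @^-1` _ = ~` [set x | f x i]); first exact: measurableC.
by apply/seteqP; split=> x /=; [move=> ->|case: (f x i)].
Qed.

Lemma measurable_cylinder n A : measurable (cylinder n A).
Proof.
have -> : cylinder n A = \bigcap_(i in `I_n) ((fun x : seqN => x i) @^-1` [set r | A i r]).
  by apply/seteqP; split=> x /= h i; exact: h.
by apply: bigcap_measurableType => // i _; exact: measurable_coordN.
Qed.

(** Cylinders are closed under intersection and generate the sigma-algebra; the cylinder of length 0
    is the whole space, so finite total mass is enough for uniqueness. *)
Lemma seqN_measure_unique {R : realType} (m1 m2 : {measure set seqN -> \bar R}) :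
  (forall n A, m1 (cylinder n A) = m2 (cylinder n A)) -> (m1 setT < +oo)%E ->
  forall A, measurable A -> m1 A = m2 A.
Proof.
move=> m12 fin; pose G := [set C | exists n A, C = cylinder n A].
apply: (measure_unique G (fun=> setT)) => //.
- apply/seteqP; split.
    apply: smallest_sub; first exact: smallest_sigma_algebra.
    move=> _ [i [t ->]]; apply: sub_sigma_algebra.
    exists i.+1, (fun j => [pred r | (j == i) ==> (r == t)]); apply/seteqP.
    split=> x /=.
      by move=> <- j _; apply/implyP => /eqP ->.
    by move=> /(_ i (ltnSn i)); rewrite eqxx => /eqP.
  apply: smallest_sub; first exact: sigma_algebra_measurable.
  by move=> _ [n [A ->]]; exact: measurable_cylinder.
- move=> _ _ [n [A ->]] [m [A' ->]].
  exists (maxn n m), (fun i => [pred r | ((i < n)%N ==> A i r) && ((i < m)%N ==> A' i r)]).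
  apply/seteqP; split=> x /=.
    move=> [h1 h2] i _; apply/andP.
    by split; apply/implyP => ilt; [exact: h1|exact: h2].
  move=> h; split=> i ilt.
    have /h/andP[/implyP/(_ ilt)//] : (i < maxn n m)%N by rewrite leq_max ilt.
  have /h/andP[_ /implyP/(_ ilt)//] : (i < maxn n m)%N by rewrite leq_max ilt orbT.
- move=> _; exists 0%N, (fun=> predT).
  by apply/seteqP; split.
- by rewrite bigcup_const//; exists 0%N.
- by move=> A [n [A' ->]].
Qed.

(** * Rotation of Omega: uniqueness of Haar measure and ergodicity *)

(** The element (1, 1, ...) of Omega. Translation by it corresponds to the shift under [phi]. *)
Definition one_Omega (B : set nat) : seqN := fun b => if `[< B b >] then 1%N else 0%N.

Lemma translE_in (B : set nat) w x b : B b -> transl B w x b = ((x b + w b) %% b)%N.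
Proof. by move=> Bb; rewrite /transl asboolT. Qed.

Lemma translE_out (B : set nat) w x b : ~ B b -> transl B w x b = 0%N.
Proof. by move=> Bb; rewrite /transl asboolF. Qed.

Lemma transl_OmegaSet (B : set nat) w x :
  (forall b, B b -> (2 <= b)%N) -> OmegaSet B (transl B w x).
Proof.
move=> B2 b; split=> [Bb|nBb]; last by rewrite translE_out.
by rewrite translE_in// ltn_mod (leq_trans _ (B2 b Bb)).
Qed.

Lemma translC (B : set nat) v w x :
  transl B v (transl B w x) = transl B w (transl B v x).
Proof.
apply/funext => b; have [Bb|nBb] := pselect (B b); last by rewrite !translE_out.
by rewrite !translE_in// !modnDml addnAC.
Qed.

(** Translation by 0 acts as a retraction onto [OmegaSet B]: it reduces coordinates in B modulo b
    and clears the others. *)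
Definition reduce (B : set nat) (x : seqN) : seqN := transl B (fun=> 0%N) x.

Lemma reduce_id (B : set nat) x : OmegaSet B x -> reduce B x = x.
Proof.
move=> Ox; apply/funext => b; have [xin xout] := Ox b.
have [Bb|nBb] := pselect (B b); first by rewrite /reduce translE_in// addn0 modn_small// xin.
by rewrite /reduce translE_out// xout.
Qed.

Lemma measurable_transl (B : set nat) w : measurable_fun setT (transl B w).
Proof.
apply: measurable_fun_seqN => b r; have [Bb|nBb] := pselect (B b).
  have -> : [set x | transl B w x b = r] =
      (fun x : seqN => x b) @^-1` [set t | (t + w b) %% b = r]%N.
    by apply/seteqP; split=> x /=; rewrite translE_in.
  exact: measurable_coordN.
have [->|r0] := eqVneq r 0%N.
  by rewrite (_ : [set _ | _] = setT)//; apply/seteqP; split=> x //= _; rewrite translE_out.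
rewrite (_ : [set _ | _] = set0)//; apply/seteqP; split=> x //=.
by rewrite translE_out// => /esym/eqP; rewrite (negbTE r0).
Qed.

Lemma preimage_measurable {d d'} {X : measurableType d} {Y : measurableType d'}
  (f : X -> Y) (A : set Y) :
  measurable_fun setT f -> measurable A -> measurable (f @^-1` A).
Proof. by move=> mf mA; rewrite -[X in measurable X]setTI; exact: mf. Qed.

Lemma coprime_prod_set (B : set nat) n :
  (forall b c, B b -> B c -> b <> c -> coprime b c) -> B n ->
  coprime (\prod_(i < n | `[< B i >]) i) n.
Proof.
move=> co Bn; apply: (big_ind (fun m => coprime m n)); first exact: coprime1n.
  by move=> a b ca cb; rewrite coprimeMl ca.
move=> i /asboolP Bi; apply: co => // /esym ni.
by have := ltn_ord i; rewrite -{1}ni ltnn.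
Qed.

(* Probability, under the Haar measure, that the [i]-th coordinate satisfies [A i]. *)
Definition coord_weight {R : realType} (B : set nat) (A : nat -> pred nat) (i : nat) : R :=
  if `[< B i >] then (\sum_(r < i) A i r)%:R / i%:R else (A i 0%N)%:R.

Lemma iter_transl_one (B : set nat) n x b : B b ->
  (reduce B (iter n (transl B (one_Omega B)) x) b = (x b + n) %% b)%N.
Proof.
move=> Bb; rewrite /reduce translE_in// addn0; elim: n => [|n IH]; first by rewrite addn0.
rewrite iterS translE_in// /one_Omega asboolT//.
by rewrite -modnDml modn_mod -modnDml modn_mod IH modnDml addn1 addnS.
Qed.

(** Coordinates are peeled off one at a time, each being uniform and independent of [E] and of the
    earlier ones. Taking [E = setT] determines the measure; a general invariant [E] gives
    ergodicity. *)
Lemma measure_cylinder {R : realType} (B : set nat) (P : probability seqN R)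
    (E : set seqN) n A :
  (forall b, B b -> (2 <= b)%N) ->
  (forall b c, B b -> B c -> b <> c -> coprime b c) ->
  P.-negligible (~` OmegaSet B) -> Defs.invariant (transl B (one_Omega B)) P ->
  measurable E -> transl B (one_Omega B) @^-1` E = E ->
  P (E `&` cylinder n A) = (P E * (\prod_(i < n) coord_weight B A i)%:E)%E.
Proof.
move=> B2 co nO invP mE TE.
pose T := transl B (one_Omega B).
have mT : measurable_fun setT T by exact: measurable_transl.
(* The pullback under [reduce] agrees with the cylinder off a null set and makes the coordinates
   genuine residues everywhere. *)
pose C k := reduce B @^-1` cylinder k A.
have mC k : measurable (C k).
  by apply: preimage_measurable; [exact: measurable_transl|exact: measurable_cylinder].
have -> : P (E `&` cylinder n A) = P (E `&` C n).
  apply: eq_measure_off_negligible nO _ _ _.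
  - by apply: measurableI => //; exact: measurable_cylinder.
  - exact: measurableI.
  - by move=> x /contrapT Ox; rewrite /C/= reduce_id.
elim: n => [|n IH].
  rewrite big_ord0 mule1; congr (P _).
  by apply/seteqP; split=> x /= => [[]|].
rewrite big_ord_recr/= EFinM muleA -IH.
have CS : C n.+1 = C n `&` [set x | A n (reduce B x n)].
  apply/seteqP; split=> x.
    by move=> h; split=> [i lin|]; apply: h => //; exact: ltnW.
  by move=> [h h'] i; rewrite ltnS leq_eqVlt => /predU1P[->|/h].
rewrite CS setIA /coord_weight; case: asboolP => [Bn|nBn]; last first.
  case HA: (A n 0%N).
    rewrite mule1; congr (P _); apply/seteqP; split=> x /=; first by case.
    by move=> ?; split=> //; rewrite /reduce translE_out.
  rewrite mule0 (_ : _ `&` _ = set0) ?measure0//.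
  by apply/seteqP; split=> x //=; rewrite /reduce translE_out// HA => -[].
have n0 : (0 < n)%N by exact: leq_trans (B2 n Bn).
pose th (x : seqN) := reduce B x n.
have mth r : measurable (th @^-1` [set r]).
  apply: (preimage_measurable (reduce B) ((fun x : seqN => x n) @^-1` [set r])).
    exact: measurable_transl.
  exact: measurable_coordN.
have thn x : (th x < n)%N by rewrite /th /reduce translE_in// ltn_mod.
rewrite (measure_fiber_sum P (E `&` C n) n th (A n))//; last exact: measurableI.
(* The moduli below n divide [N], so [iter N T] fixes the earlier residues, while [N] is coprime to
   n and moves the residue at n through all classes. *)
pose N := (\prod_(i < n | `[< B i >]) i)%N.
have TN : iter N T @^-1` (E `&` C n) = E `&` C n.
  rewrite preimage_setI; congr (_ `&` _).
    by elim: N => [|N IHN]//; rewrite -[RHS]IHN -{2}TE.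
  suff rT x i : (i < n)%N -> reduce B (iter N T x) i = reduce B x i.
    by apply/seteqP; split=> x h i lin; move: (h i lin); rewrite rT.
  move=> lin; have [Bi|nBi] := pselect (B i); last by rewrite /reduce !translE_out.
  rewrite iter_transl_one// /reduce translE_in// addn0.
  rewrite /N (bigD1 (Ordinal lin))//=; last exact/asboolP.
  by rewrite addnC mulnC modnMDl.
under eq_bigr => r Ar.
  rewrite (equivariant_residue_indep P T (E `&` C n) N n th)//; last first.
  - by move=> x; rewrite /th (iter_transl_one B 1)// /reduce translE_in// addn0 modnDml.
  - exact: coprime_prod_set.
  - exact: measurableI.
  over.
have mEC : measurable (E `&` C n) by exact: measurableI.
rewrite -(fineK (fin_num_measure P _ mEC)) -!EFinM sumEFin; congr (_%:E).
rewrite -mulr_suml mulrCA mulrA; congr (_ * _).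
rewrite big_mkcond/= natr_sum mulr_suml; apply: eq_bigr => r _.
by case: (A n r); rewrite ?mul1r ?mul0r.
Qed.

Lemma measurable_OmegaSet (B : set nat) : measurable (OmegaSet B).
Proof.
have -> : OmegaSet B = \bigcap_b ((fun x : seqN => x b) @^-1`
    [set r | (B b -> (r < b)%N) /\ (~ B b -> r = 0%N)]).
  by apply/seteqP; split=> x /= h b; [move=> _|]; exact: h.
by apply: bigcap_measurableType => b _; exact: measurable_coordN.
Qed.

(** Translation by [w] commutes with the rotation, so the translated measure [Q] satisfies the same
    hypotheses as [P], and both have the cylinder values of [measure_cylinder]. *)
Lemma invariant_haar {R : realType} (B : set nat) (P : probability seqN R) :
  (forall b, B b -> (2 <= b)%N) ->
  (forall b c, B b -> B c -> b <> c -> coprime b c) ->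
  P.-negligible (~` OmegaSet B) -> Defs.invariant (transl B (one_Omega B)) P ->
  haar_Omega B P.
Proof.
move=> B2 co nO invP; split=> // w Ow.
have mw := measurable_transl B w.
pose W : {mfun seqN >-> seqN} := mfun_Sub (mem_set mw).
pose Q : probability seqN R := distribution P W.
have nOQ : Q.-negligible (~` OmegaSet B).
  exists (~` OmegaSet B); split=> //; first by apply: measurableC; exact: measurable_OmegaSet.
  rewrite /Q/= /distribution/= /pushforward/=.
  rewrite (_ : _ @^-1` _ = set0) ?measure0//.
  by apply/seteqP; split=> x //=; apply; exact: transl_OmegaSet.
have invQ : Defs.invariant (transl B (one_Omega B)) Q.
  move=> A mA; rewrite /Q/= /distribution/= /pushforward/=.
  rewrite -[RHS]invP; last exact: preimage_measurable.
  by congr (P _); apply/seteqP; split=> x; rewrite /preimage/= translC.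
apply: (seqN_measure_unique Q P).
  move=> n A.
  have := measure_cylinder B P setT n A B2 co nO invP measurableT (preimage_setT _).
  have := measure_cylinder B Q setT n A B2 co nOQ invQ measurableT (preimage_setT _).
  by rewrite !setTI !probability_setT => hQ hP; exact: etrans hQ (esym hP).
exact: le_lt_trans (probability_le1 Q measurableT) (ltry _).
Qed.

(** An invariant set is independent of every cylinder, hence of every measurable set, in particular
    of itself; so its measure p satisfies p = p^2. *)
Lemma invariant_ergodic {R : realType} (B : set nat) (P : probability seqN R) :
  (forall b, B b -> (2 <= b)%N) ->
  (forall b c, B b -> B c -> b <> c -> coprime b c) ->
  P.-negligible (~` OmegaSet B) -> Defs.invariant (transl B (one_Omega B)) P ->
  ergodic (transl B (one_Omega B)) P.
Proof.
move=> B2 co nO invP; split=> // E mE TE.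
have PE := fineK (fin_num_measure P _ mE).
have PE0 : 0 <= fine (P E) by exact: fine_ge0.
have indep A : measurable A -> P (A `&` E) = (P E * P A)%E.
  rewrite -PE; apply: (seqN_measure_unique (mrestr P mE) (mscale (NngNum PE0) P)).
    move=> n A'; change (P (cylinder n A' `&` E) = (fine (P E))%:E * P (cylinder n A'))%E.
    rewrite setIC (measure_cylinder B)// PE; congr (_ * _)%E.
    have := measure_cylinder B P setT n A' B2 co nO invP measurableT (preimage_setT _).
    by rewrite setTI probability_setT mul1e.
  by change (P (setT `&` E) < +oo)%E; rewrite setTI -PE ltry.
have := indep E mE; rewrite setIid -PE -EFinM => -[].
move/eqP; rewrite -{1}(mulr1 (fine _)) -subr_eq0 -mulrBr mulf_eq0 subr_eq0.
by case/orP => /eqP; [move->; left|move<-; right].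
Qed.

(** * A counting sieve, and the blocks occurring in [eta] *)

Lemma Bfree_tail {R : realType} (B : set nat) (e : R) :
  Bfree_basis R B -> 0 < e -> exists K0, forall K Y, (K0 <= K)%N ->
  \sum_(b < Y | (K <= b)%N && `[< B b >]) (b%:R : R)^-1 <= e.
Proof.
move=> [_ _ fin] e0.
have pos b : (0 <= ((b%:R : R)^-1)%:E)%E by rewrite lee_fin invr_ge0.
have /fine_cvgP[_ /cvgrPdist_le/(_ e e0)] := nneseries_tail_cvg fin (fun b _ => pos b).
move=> [K0 _ HK0]; exists K0 => K Y KK.
have {HK0} := HK0 K KK; rewrite /= sub0r normrN ger0_norm; last first.
  by apply: fine_ge0; apply: nneseries_ge0 => b _ _; exact: pos.
apply: le_trans; rewrite -lee_fin fineK; last first.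
  rewrite ge0_fin_numE; last by apply: nneseries_ge0 => b _ _; exact: pos.
  apply: le_lt_trans fin.
  rewrite [leRHS](@nneseries_split_cond _ _ 0 K)// add0n leeDr//.
  by apply: sume_ge0 => b _; exact: pos.
have := @nneseries_lim_ge R (fun b => ((b%:R : R)^-1)%:E) (fun b => b \in B) K Y (fun b _ _ => pos b).
apply: le_trans; rewrite sumEFin lee_fin.
have [KY|/ltnW YK] := leqP K Y; last first.
  rewrite big_pred0; last by move=> b; rewrite leqNgt (leq_trans (ltn_ord b)).
  exact: sumr_ge0.
rewrite (big_nat_widenl _ 0)// big_mkord//.
rewrite le_eqVlt; apply/orP; left; apply/eqP; apply: eq_bigl => b; rewrite andbC; congr (_ && _).
Qed.

(** As [N] is invertible modulo b, the solutions t lie in one class modulo b, so t is recovered from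
    [t %/ b]. *)
Lemma count_dvdn_progression (a N b X : nat) : (0 < b)%N -> coprime N b ->
  (\sum_(t < X) (b %| a + N * t)%N <= X %/ b + 1)%N.
Proof.
move=> b0 co; pose S := [set t : 'I_X | (b %| a + N * t)%N]%SET.
have -> : (\sum_(t < X) (b %| a + N * t)%N)%N = #|S|.
  rewrite -sum1_card [RHS]big_mkcond/=; apply: eq_bigr => t _.
  by rewrite inE; case: (b %| _)%N.
have tX (t : 'I_X) : (t %/ b < (X %/ b).+1)%N by rewrite ltnS leq_div2r// ltnW.
pose f t : 'I_(X %/ b).+1 := Ordinal (tX t).
rewrite addn1 -[X in (_ <= X)%N]card_ord -(@card_in_imset _ _ f S); first exact: max_card.
move=> s t; rewrite !inE => /dvdnP[u Hu] /dvdnP[v Hv] [] fst_.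
apply: val_inj => /=; rewrite (divn_eq s b) (divn_eq t b) fst_; congr (_ + _)%N.
have /eqP : (N * s = N * t %[mod b])%N.
  by apply/eqP; rewrite -(eqn_modDl a) Hu Hv !modnMl.
wlog st : s t u v Hu Hv fst_ / (s <= t)%N => [H|].
  have [st|ts] := leqP s t; first exact: (H s t u v).
  by rewrite eq_sym => h; apply/esym; apply: (H t s v u) => //; exact: ltnW.
rewrite eq_sym eqn_mod_dvd ?leq_mul2l ?st ?orbT// -mulnBr Gauss_dvdr 1?coprime_sym//.
by rewrite -eqn_mod_dvd// => /eqP.
Qed.

(** For each j a modulus b excludes at most [X %/ b + 1] values [t < X]. Only moduli up to a
    multiple of X can divide the terms, and smallness of the tail makes the total excluded less than
    X once X is large. *)
Lemma sieve {R : realType} (B : set nat) (len K a N : nat) :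
  Bfree_basis R B -> (0 < a)%N ->
  (forall Y, \sum_(b < Y | (K <= b)%N && `[< B b >]) (b%:R : R)^-1 <=
     (4 * len.+1%:R)^-1) ->
  (forall b, B b -> (K <= b)%N -> coprime N b) ->
  exists t, forall b j, B b -> (K <= b)%N -> (j < len)%N -> ~~ (b %| a + N * t + j)%N.
Proof.
move=> HB a0 tailK co; apply: contrapT => nex.
have bad t : exists b j, [/\ B b, (K <= b)%N, (j < len)%N & (b %| a + N * t + j)%N].
  apply: contrapT => nb; apply: nex; exists t => b j Bb Kb jl; apply/negP => bd.
  by apply: nb; exists b, j.
have B2 : forall b, B b -> (2 <= b)%N by case: HB.
pose L : R := len.+1%:R.
have L0 : 0 < L by rewrite ltr0n.
(* For positive [X], [M * X] bounds every [a + N * t + j] with [t < X] and [j < len]; such a term is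
   nonzero since [0 < a], so it bounds the divisors as well. *)
pose M := (a + N + len)%N.
have M0 : (0 < M)%N by rewrite /M -addnA ltn_addr.
have e20 : 0 < (4 * L * M%:R)^-1 :> R by rewrite invr_gt0 !mulr_gt0// ltr0n.
have [K' /(_ K') tailK'] := Bfree_tail B _ HB e20.
(* This makes [X / (4 * L)] equal to [K'.+1], so that the final comparison is between 4 (len + 1)
   (K' + 1) and len (3 K' + 2). *)
pose X := (4 * len.+1 * K'.+1)%N.
have X0 : (0 < X)%N by rewrite !muln_gt0.
pose Y := (M * X).+1.
pose Q b := (K <= b)%N && `[< B b >].
have H1 : (X <= \sum_(j < len) \sum_(b < Y | Q b) (X %/ b + 1))%N.
  have : (X <= \sum_(t < X) \sum_(j < len) \sum_(b < Y | Q b) (b %| a + N * t + j)%N)%N.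
    rewrite -{1}(card_ord X) -sum1_card; apply: leq_sum => t _.
    have [b [j [Bb Kb jl bd]]] := bad t.
    have bY : (b < Y)%N.
      rewrite ltnS (leq_trans (dvdn_leq _ bd))//; first by rewrite -addnA ltn_addr.
      rewrite /M !mulnDl leq_add//; last by rewrite (leq_trans (ltnW jl))// leq_pmulr.
      by rewrite leq_add ?leq_pmulr// leq_mul2l ltnW ?orbT.
    rewrite (bigD1 (Ordinal jl))//= (bigD1 (Ordinal bY))/=; last by rewrite /Q Kb; apply/asboolP.
    by rewrite bd -addnA leq_addr.
  move/leq_trans; apply.
  rewrite exchange_big/=; apply: leq_sum => j _.
  rewrite exchange_big/=; apply: leq_sum => b /andP[Kb /asboolP Bb].
  under eq_bigr do rewrite addnAC.
  apply: count_dvdn_progression; last exact: co.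
  by apply: leq_trans (B2 _ Bb).
have H2 : \sum_(b < Y | Q b) ((X %/ b + 1)%:R : R) <=
    X%:R / (4 * L) + (K'%:R + X%:R / (4 * L)).
  have -> : \sum_(b < Y | Q b) ((X %/ b + 1)%:R : R) =
     \sum_(b < Y | Q b) ((X %/ b)%:R : R) + \sum_(b < Y | Q b) 1.
    by rewrite -big_split; apply: eq_bigr => b _; rewrite natrD.
  apply: lerD.
    apply: (@le_trans _ _ (\sum_(b < Y | Q b) (X%:R * (b%:R)^-1))).
      apply: ler_sum => b /andP[_ /asboolP Bb].
      have b0 : (0 < b)%N by apply: leq_trans (B2 _ Bb).
      by rewrite ler_pdivlMr ?ltr0n// -natrM ler_nat leq_divM.
    by rewrite -mulr_sumr ler_wpM2l.
  (* The error terms 1 are counted: at most [K'] of them have [b < K'], and beyond that [b <= M * X]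
     gives 1 <= M X / b, to which the second tail bound applies. *)
  rewrite (bigID (fun b : 'I_Y => (b < K')%N))/=; apply: lerD.
    apply: (@le_trans _ _ (\sum_(b < Y | (b < K')%N) 1)).
      by rewrite [leLHS]big_mkcond [leRHS]big_mkcond/=; apply: ler_sum => b _;
        case: (Q b); case: (b < K')%N.
    rewrite (_ : \sum_(b < Y | _) 1 = (\sum_(b < Y | (b < K')%N) 1)%:R); last by rewrite natr_sum.
    rewrite ler_nat -(big_mkord (fun b => (b < K')%N) (fun=> 1%N)).
    rewrite sum1_count -size_filter -[X in (_ <= X)%N](size_iota 0 K').
    apply: uniq_leq_size; first by rewrite filter_uniq ?iota_uniq.
    by move=> b; rewrite mem_filter !mem_iota/= => /andP[].
  apply: (@le_trans _ _ (\sum_(b < Y | (K' <= b)%N && `[< B b >]) ((M * X)%:R * (b%:R)^-1))).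
    apply: (@le_trans _ _ (\sum_(b < Y | Q b && ~~ (b < K')%N) ((M * X)%:R * (b%:R)^-1))).
      apply: ler_sum => b /andP[/andP[_ /asboolP Bb] _].
      have b0 : (0 < b)%N by apply: leq_trans (B2 _ Bb).
      by rewrite ler_pdivlMr ?ltr0n// mul1r ler_nat -ltnS.
    rewrite [leLHS]big_mkcond [leRHS]big_mkcond/=; apply: ler_sum => b _.
    rewrite /Q -leqNgt; have F0 : 0 <= (M * X)%:R * (b%:R)^-1 :> R by rewrite mulr_ge0// invr_ge0.
    by case: (K <= b)%N; case: asbool; case: (K' <= b)%N.
  rewrite -mulr_sumr; apply: (le_trans (ler_wpM2l _ (tailK' Y (leqnn _)))) => //.
  rewrite le_eqVlt; apply/orP; left; apply/eqP; rewrite natrM; field.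
  by rewrite !gt_eqF// ltr0n.
have : (X%:R : R) <= len%:R * (X%:R / (4 * L) + (K'%:R + X%:R / (4 * L))).
  apply: (@le_trans _ _ (\sum_(j < len) (\sum_(b < Y | Q b) (X %/ b + 1)%:R))).
    by under eq_bigr do rewrite -natr_sum; rewrite -natr_sum ler_nat.
  by apply: (le_trans (ler_sum _ (fun j _ => H2))); rewrite sumr_const card_ord [leRHS]mulr_natl.
have -> : X%:R / (4 * L) = K'.+1%:R.
  by rewrite /X 2!natrM mulrC mulKf// mulf_neq0// gt_eqF.
rewrite (_ : _ * _ = (len * (K'.+1 + (K' + K'.+1)))%:R :> R); last by rewrite natrM !natrD.
rewrite ler_nat /X; apply/negP; rewrite -ltnNge; lia.
Qed.

Lemma dvdz_add_nat (b m : nat) (n : nat) : (b%:Z %| m%:Z + n%:Z)%Z = (b %| m + n)%N.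
Proof. by rewrite -PoszD dvdzE. Qed.

Lemma crt_set (B : set nat) (c : nat -> nat) n :
  (forall b c, B b -> B c -> b <> c -> coprime b c) ->
  exists a, forall b, B b -> (b < n)%N -> (a = c b %[mod b])%N.
Proof.
move=> co; elim: n => [|n [a IH]]; first by exists 0%N.
have [Bn|nBn] := pselect (B n); last first.
  exists a => b Bb; rewrite ltnS leq_eqVlt => /predU1P[bn|]; last exact: IH.
  by case: nBn; rewrite -bn.
pose N := (\prod_(i < n | `[< B i >]) i)%N.
have cN : coprime N n by exact: coprime_prod_set.
exists (chinese N n a (c n)) => b Bb; rewrite ltnS leq_eqVlt => /predU1P[->|bn].
  exact: chinese_modr.
rewrite -(IH b Bb bn); have bN : (b %| N)%N.
  by rewrite /N (bigD1 (Ordinal bn))/= ?dvdn_mulr//; exact/asboolP.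
by rewrite -(modn_dvdm _ bN) chinese_modl// modn_dvdm.
Qed.

(** Each zero of the block is caused by some modulus. Matching [c] modulo all moduli below a bound
    [K] that exceeds these reproduces the zeros, and [sieve] keeps the moduli from [K] on from
    creating new ones. *)
Lemma eta_realizes_phi {R : realType} (B : set nat) (c : seqN) (len : nat) :
  Bfree_basis R B ->
  exists k : int, forall j, (j < len)%N -> Defs.eta B (k + j%:Z) = Defs.phi B c j%:Z.
Proof.
move=> HB; have [B2 co _] := HB.
have e0 : 0 < (4 * len.+1%:R)^-1 :> R by rewrite invr_gt0 mulr_gt0// ltr0n.
have [K0 HK0] := Bfree_tail B _ HB e0.
(* [g j] is a modulus causing the zero at j, and is 0 when there is no zero. *)
have [g gP] : {g : nat -> nat & forall j,
    (exists b, B b /\ (b %| c b + j)%N) -> B (g j) /\ (g j %| c (g j) + j)%N}.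
  apply: (@choice _ _ (fun j b' => (exists b, B b /\ (b %| c b + j)%N) ->
    B b' /\ (b' %| c b' + j)%N)).
  move=> j; have [[b hb]|nb] := pselect (exists b, B b /\ (b %| c b + j)%N).
    by exists b.
  by exists 0%N.
pose K := maxn K0 (\max_(j < len) (g j).+1).
have gK j : (j < len)%N -> (g j < K)%N.
  move=> jl; rewrite /K leq_max; apply/orP; right.
  exact: (leq_bigmax (Ordinal jl)).
pose N := (\prod_(i < K | `[< B i >]) i)%N.
have [a0 aP] := crt_set B c K co.
have bN b : B b -> (b < K)%N -> (b %| N)%N.
  by move=> Bb bK; rewrite /N (bigD1 (Ordinal bK))/= ?dvdn_mulr//; exact/asboolP.
have N0 : (0 < N)%N.
  by apply: prodn_cond_gt0 => i /asboolP Bi; apply: leq_trans (B2 _ Bi).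
have coN b : B b -> (K <= b)%N -> coprime N b.
  move=> Bb Kb; apply: (big_ind (fun m => coprime m b)); first exact: coprime1n.
    by move=> x y cx cy; rewrite coprimeMl cx.
  move=> i /asboolP Bi; apply: co => // ib.
  by have := ltn_ord i; rewrite ib ltnNge Kb.
(* Starting at [a0 + N] instead of [a0] makes the first term positive and leaves the residues modulo
   the small moduli unchanged. *)
have [t tP] := @sieve R B len K (a0 + N)%N N HB (ltn_addl _ N0)
  (fun Y => HK0 K Y (leq_maxl _ _)) coN.
exists ((a0 + N) + N * t)%N%:Z => j jl; apply: asbool_equiv_eq.
have red b : B b -> (b < K)%N ->
    (b %| a0 + N + N * t + j)%N = (b %| c b + j)%N.
  move=> Bb bK; have e : (a0 + N + N * t = a0 %[mod b])%N.
    have [q ->] := dvdnP (bN b Bb bK).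
    by rewrite -addnA -mulnS mulnAC addnC modnMDl.
  by rewrite /dvdn -modnDml e aP// modnDml.
split=> h b Bb; rewrite dvdz_add_nat => bd.
  have [Bg gd] := gP j (ex_intro _ b (conj Bb bd)).
  by apply: (h _ Bg); rewrite dvdz_add_nat red// gK.
have [bK|Kb] := ltnP b K; last by move: (tP b j Bb Kb jl); rewrite bd.
by apply: (h b Bb); rewrite dvdz_add_nat -red.
Qed.

(** * Criteria for membership in [Xeta], and missed residue classes *)

Lemma Xeta_window {R : realType} (B : set nat) (y : seqZ) :
  Bfree_basis R B ->
  (forall (m : int) (len : nat), exists c : seqN,
     forall j, (j < len)%N -> y (m + j%:Z) = Defs.phi B c j%:Z) -> Xeta B y.
Proof.
move=> HB H m len; have [c cP] := H m len.
have [k kP] := eta_realizes_phi B c len HB.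
by exists k => j jl; rewrite cP// kP.
Qed.

(** Adding m to every residue moves the window to the origin, so that only blocks indexed by natural
    numbers have to be treated. *)
Lemma phi_recenter (B : set nat) (w : seqN) (m : int) :
  (forall b, B b -> (2 <= b)%N) ->
  exists c : seqN, forall j : nat, Defs.phi B w (m + j%:Z) = Defs.phi B c j%:Z.
Proof.
move=> B2; exists (fun b => `|((w b)%:Z + m) %% b%:Z|%Z%N) => j.
apply: asbool_equiv_eq.
suff H b : B b -> (b%:Z %| (w b)%:Z + (m + j%:Z))%Z =
    (b%:Z %| `|((w b)%:Z + m) %% b%:Z|%Z%N%:Z + j%:Z)%Z.
  by split=> h b Bb; [rewrite -H//|rewrite H//]; exact: h.
move=> Bb; rewrite gez0_abs; last by rewrite modz_ge0// -lt0n (leq_trans _ (B2 b Bb)).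
rewrite addrA; apply/dvdz_mod0P/dvdz_mod0P; by rewrite -modzDml => <-; rewrite ?modzDml.
Qed.

Lemma Xeta_phi {R : realType} (B : set nat) (w : seqN) :
  Bfree_basis R B -> Xeta B (Defs.phi B w).
Proof.
move=> HB; apply: (Xeta_window B _ HB) => m len.
have [c cP] := phi_recenter B w m (let: And3 h _ _ := HB in h).
by exists c => j _; exact: cP.
Qed.

Lemma infinite_set_ge (B : set nat) n :
  infinite_set B -> exists b, B b /\ (n <= b)%N.
Proof.
move=> infB; apply: contrapT => nb; apply: infB.
apply: (@sub_finite_set _ _ `I_n); last exact: finite_II.
by move=> b Bb /=; rewrite ltnNge; apply/negP => nbb; apply: nb; exists b.
Qed.

(** The missing zeros are created one by one, each at the cost of a fresh large modulus whose
    residue is reset to vanish at that position; infinitude of B supplies these moduli. *)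
Lemma phi_realizes_sub (B : set nat) (y : seqZ) (c0 : seqN) (len : nat) :
  infinite_set B ->
  (forall j : nat, y j%:Z -> Defs.phi B c0 j%:Z) ->
  exists c : seqN, forall j : nat, (j < len)%N -> y j%:Z = Defs.phi B c j%:Z.
Proof.
move=> infB y0.
(* The bound [K] on the moduli already responsible for zeros allows residues at moduli beyond it to
   be changed freely. *)
suff [c [K [c1 c2]]] : exists (c : seqN) (K : nat),
    (forall j : nat, (j < len)%N -> y j%:Z -> Defs.phi B c j%:Z) /\
    (forall j : nat, (j < len)%N -> ~~ y j%:Z ->
      exists b, [/\ B b, (b < K)%N & (b %| c b + j)%N]).
  exists c => j jl; apply/idP/idP; first exact: c1.
  move/asboolP => h; apply/negP => /negP /(c2 _ jl)[b [Bb _ bd]].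
  by apply: (h b Bb); rewrite dvdz_add_nat.
suff : forall l, exists (c : seqN) (K : nat),
    (forall j : nat, (j < len)%N -> y j%:Z -> Defs.phi B c j%:Z) /\
    (forall j : nat, (j < l)%N -> ~~ y j%:Z ->
      exists b, [/\ B b, (b < K)%N & (b %| c b + j)%N]) by exact.
elim=> [|l [c [K [c1 c2]]]].
  by exists c0, 0%N; split => // j _; exact: y0.
have [yl|nyl] := boolP (y l%:Z).
  exists c, K; split=> // j; rewrite ltnS leq_eqVlt => /predU1P[->|]; last exact: c2.
  by rewrite yl.
have [b [Bb bge]] := infinite_set_ge B (K + len + l).+1 infB.
have Kb : (K < b)%N by apply: leq_trans bge; rewrite ltnS -addnA leq_addr.
have lb : (l < b)%N by apply: leq_trans bge; rewrite ltnS leq_addl.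
have lenb : (len < b)%N by apply: leq_trans bge; rewrite ltnS addnAC leq_addl.
(* With residue [b - l] the modulus b causes a zero at l, and nowhere else in the window because
   [len < b]. *)
exists (fun x => if x == b then (b - l)%N else c x), b.+1; split=> j jlt.
  move=> yj; apply/asboolP => x Bx; rewrite dvdz_add_nat.
  have [->|xb] := eqVneq x b; last first.
    by have /asboolP/(_ x Bx) := c1 j jlt yj; rewrite dvdz_add_nat.
  move=> bd; have : (j == l %[mod b])%N.
    by rewrite -(eqn_modDl (b - l)) (subnK (ltnW lb)) modnn; exact: bd.
  rewrite !modn_small//; last exact: ltn_trans lenb.
  by move=> /eqP jl'; move: nyl; rewrite -jl' yj.
move=> nyj; move: jlt; rewrite ltnS leq_eqVlt => /predU1P[->|jl].
  by exists b; rewrite eqxx subnK ?(ltnW lb)//; split.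
have [x [Bx xK xd]] := c2 j jl nyj.
exists x; have xb : (x < b)%N := ltn_trans xK Kb.
by rewrite ltn_eqF//; split=> //; exact: leqW.
Qed.

Lemma Xeta_infinite {R : realType} (B : set nat) (y : seqZ) (w : seqN) :
  Bfree_basis R B -> infinite_set B -> (forall n, y n -> Defs.phi B w n) -> Xeta B y.
Proof.
move=> HB infB yw; apply: (Xeta_window B _ HB) => m len.
have [c0 c0P] := phi_recenter B w m (let: And3 h _ _ := HB in h).
have [c cP] : exists c : seqN, forall j : nat, (j < len)%N ->
    y (m + j%:Z) = Defs.phi B c j%:Z.
  apply: (phi_realizes_sub B (fun n => y (m + n)) c0 len infB) => j /yw.
  by rewrite c0P.
by exists c.
Qed.

(** [eta] vanishes on the multiples of b. If y met every class, a finite window containing one hit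
    per class would occur in [eta], and one of the hits would fall on a multiple of b. *)
Lemma Xeta_missing (B : set nat) (y : seqZ) b :
  Xeta B y -> B b -> (0 < b)%N ->
  exists r : nat, (r < b)%N /\ forall n : int, (b%:Z %| r%:Z + n)%Z -> ~~ y n.
Proof.
move=> Xy Bb b0; apply: contrapT => nr.
have bad r : exists n : int, (r < b)%N -> (b%:Z %| r%:Z + n)%Z && y n.
  have [rb|] := ltnP r b; last by exists 0.
  apply: contrapT => nn; apply: nr; exists r; split=> // n bd; apply/negP => yn.
  by apply: nn; exists n; rewrite bd.
have [n nP] := choice bad.
pose L := (\max_(r < b) `|n r|)%N.
have nL r : (r < b)%N -> (`|n r| <= L)%N.
  by move=> rb; exact: (leq_bigmax (Ordinal rb)).
have [k kP] := Xy (- L%:Z) (L + L).+1.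
(* The class whose hit [n r] lands on a multiple of b when the window starting at -L is copied to
   k. *)
pose r := `|((k + L%:Z) %% b%:Z)%Z|%N.
have rE : r%:Z = ((k + L%:Z) %% b%:Z)%Z by rewrite /r gez0_abs// modz_ge0// gt_eqF.
have rb : (r < b)%N by rewrite -ltz_nat rE ltz_pmod.
have /andP[bd yn] := nP r rb.
pose j := `|(n r + L%:Z)%R|%N.
have nrL : 0 <= n r + L%:Z by have := nL r rb; lia.
have jE : j%:Z = n r + L%:Z by rewrite /j gez0_abs.
have jL : (j < (L + L).+1)%N by have := nL r rb; lia.
have := kP j jL; rewrite jE addrC addrK yn => /esym/asboolP/(_ b Bb); apply.
rewrite addrCA; move: bd; rewrite rE => /dvdz_mod0P; rewrite modzDml => h.
by apply/dvdz_mod0P; rewrite -h addrC.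
Qed.

(* For finite [B], [eta B] is periodic and hits every nonzero residue class. *)
Lemma Xeta_finite_missing_unique (B : set nat) (y : seqZ) b :
  (forall b, B b -> (2 <= b)%N) ->
  (forall b c, B b -> B c -> b <> c -> coprime b c) ->
  finite_set B -> Xeta B y -> B b -> forall r s : nat,
  (forall n : int, (b%:Z %| r%:Z + n)%Z -> ~~ y n) ->
  (forall n : int, (b%:Z %| s%:Z + n)%Z -> ~~ y n) -> (r = s %[mod b])%N.
Proof.
move=> B2 co finB Xy Bb.
have [K KP] : exists K, forall c, B c -> (c < K)%N.
  have /finite_seqP[s Bs] := finB.
  exists (\max_(c <- s) c).+1 => c; rewrite Bs /= => cs.
  by rewrite ltnS; exact: leq_bigmax_seq.
pose N := (\prod_(i < K | `[< B i >]) i)%N.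
have cN c : B c -> (c %| N)%N.
  by move=> Bc; rewrite /N (bigD1 (Ordinal (KP c Bc)))/= ?dvdn_mulr//; exact/asboolP.
have N0 : (0 < N)%N.
  by apply: prodn_cond_gt0 => i /asboolP Bi; apply: leq_trans (B2 _ Bi).
have [k kP] := Xy 0 N.
(* The place k where one full period of y occurs in [eta] determines the missed class, so any two
   missed classes agree. *)
suff H (r : nat) : (forall n : int, (b%:Z %| r%:Z + n)%Z -> ~~ y n) ->
    (k = r%:Z %[mod b%:Z])%Z.
  by move=> r s hr hs; apply/eqP; rewrite -eqz_nat -!modz_nat -!H.
move=> hr; apply/eqP/contraT => kr.
(* Pick [n] in the window with [n = - r mod b] and [k + n = 1 mod c] for the other moduli. *)
have [a aP] := crt_set B (fun c => if c == b then `|(- r%:Z %% b%:Z)%Z|%N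
  else `|((1 - k) %% c%:Z)%Z|%N) K co.
pose n := (a %% N)%N.
have nP c : B c -> ((n%:Z : int) = (if c == b then - r%:Z else 1 - k) %[mod c%:Z])%Z.
  move=> Bc; have c0 : (0 < c)%N by apply: leq_trans (B2 _ Bc).
  have : (n = a %[mod c])%N by rewrite /n modn_dvdm// cN.
  rewrite aP ?KP// => h.
  have -> : (n%:Z %% c%:Z)%Z = (n %% c)%N by rewrite modz_nat.
  rewrite h -modz_nat; case: ifP => [/eqP ->|_].
    by rewrite gez0_abs ?modz_mod// modz_ge0// gt_eqF// ltz_nat (leq_trans _ (B2 _ Bb)).
  by rewrite gez0_abs ?modz_mod// modz_ge0// gt_eqF.
have nN : (n < N)%N by rewrite ltn_mod.
have := kP n nN; rewrite add0r (negbTE (hr _ _)); last first.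
  by apply/dvdz_mod0P; rewrite -modzDmr nP// eqxx modzDmr subrr mod0z.
move=> /esym e; suff : Defs.eta B (k + n%:Z) by rewrite e.
apply/asboolP => c Bc /dvdz_mod0P.
rewrite -modzDmr nP//; case: ifP => [/eqP ->|_]; rewrite modzDmr.
  by move=> /dvdz_mod0P; rewrite -eqz_mod_dvd (negbTE kr).
rewrite addrC subrK; apply/eqP.
by rewrite modz_nat modn_small// B2.
Qed.

(** * The factor map [phi], and joinings built from maps to Omega *)

Lemma phi_transl_one (B : set nat) (w : seqN) :
  Defs.phi B (transl B (one_Omega B) w) = Sshift (Defs.phi B w).
Proof.
apply/funext => n; apply: asbool_equiv_eq.
suff H b : B b -> (b%:Z %| (transl B (one_Omega B) w b)%:Z + n)%Z =
    (b%:Z %| (w b)%:Z + (n + 1))%Z.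
  by split=> h b Bb; [rewrite -H//|rewrite H//]; exact: h.
move=> Bb; rewrite translE_in// /one_Omega asboolT// -modz_nat PoszD (addrC n) addrA.
by apply/dvdz_mod0P/dvdz_mod0P; rewrite modzDml.
Qed.

Lemma measurable_phi (B : set nat) : measurable_fun setT (Defs.phi B : seqN -> seqZ).
Proof.
apply: measurable_fun_seqZ => n.
have -> : [set w : seqN | Defs.phi B w n] =
    \bigcap_(b in B) ((fun w : seqN => w b) @^-1` [set r | ~ (b%:Z %| r%:Z + n)%Z]).
  by apply/seteqP; split=> w; [move/asboolP => h b; exact: h|move=> h; apply/asboolP].
by apply: bigcap_measurableType => b _; exact: measurable_coordN.
Qed.

Lemma countable_bigcapT_measurable {d} {X : measurableType d} {I : Type} (F : I -> set X) :
  countable [set: I] -> (forall i, measurable (F i)) -> measurable (\bigcap_i F i).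
Proof.
move=> cI mF; rewrite -[X in measurable X]setCK setC_bigcap; apply: measurableC.
by apply: countable_bigcupT_measurable => // i; exact: measurableC.
Qed.

Lemma measurable_Xeta (B : set nat) : measurable (Xeta B).
Proof.
have -> : Xeta B = \bigcap_(m : int) \bigcap_(len : nat) \bigcup_(k : int)
    \bigcap_(j in `I_len) ((fun y : seqZ => y (m + j%:Z)) @^-1` [set Defs.eta B (k + j%:Z)]).
  apply/seteqP; split=> y /= h.
    by move=> m _ len _; have [k kP] := h m len; exists k.
  by move=> m len; have [k _ kP] := h m I len I; exists k.
apply: countable_bigcapT_measurable => // m.
apply: bigcapT_measurable => len.
apply: countable_bigcupT_measurable => // k.
by apply: bigcap_measurableType => j _; exact: measurable_coordZ.
Qed.

Lemma measurable_Sshift : measurable_fun setT Sshift.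
Proof.
apply: measurable_fun_seqZ => n.
exact: (measurable_coordZ (n + 1) [set true]).
Qed.

Lemma measurable_Mmap : measurable_fun setT Mmap.
Proof.
apply: measurable_fun_seqZ => n.
have -> : [set p | Mmap p n] = (fst @^-1` ((fun x : seqZ => x n) @^-1` [set true])) `&`
   (snd @^-1` ((fun x : seqZ => x n) @^-1` [set true])).
  by apply/seteqP; split=> -[p q] /= ; [move/andP|move=> h; apply/andP].
apply: measurableI; apply: preimage_measurable.
- exact: measurable_fst.
- exact: measurable_coordZ.
- exact: measurable_snd.
- exact: measurable_coordZ.
Qed.

Lemma full_setC_negligible {d} {X : measurableType d} {R : realType}
    (mu : probability X R) (G : set X) :
  measurable G -> mu G = 1%E -> mu.-negligible (~` G).
Proof.
move=> mG G1; exists (~` G); split=> //; first exact: measurableC.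
by rewrite probability_setC// G1 subee.
Qed.

Lemma factor_to_Omega {d} {X : measurableType d} {R : realType} (mu : probability X R)
    (tau : X -> X) (G : set X) (th : X -> seqN) (B : set nat) :
  measurable_fun setT tau -> Defs.invariant tau mu -> measurable G -> mu G = 1%E ->
  measurable_fun setT th ->
  (forall x, G x -> OmegaSet B (th x) /\ th (tau x) = transl B (one_Omega B) (th x)) ->
  exists P : probability seqN R, [/\ (forall A, P A = mu (th @^-1` A)),
    P.-negligible (~` OmegaSet B) & Defs.invariant (transl B (one_Omega B)) P].
Proof.
move=> mtau inv mG G1 mth HG; have nG := full_setC_negligible mu G mG G1.
pose TH : {mfun X >-> seqN} := mfun_Sub (mem_set mth).
exists (distribution mu TH); split=> [//||A mA].
  exists (~` OmegaSet B); split=> //.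
    by apply: measurableC; exact: measurable_OmegaSet.
  change (mu (th @^-1` (~` OmegaSet B)) = 0%E).
  apply/eqP; rewrite -measure_le0.
  have [M [mM M0 GM]] := nG; rewrite -M0 (le_measure mu) ?inE//.
    by apply: (preimage_measurable th) => //; apply: measurableC; exact: measurable_OmegaSet.
  by move=> x /= nO; apply: GM => Gx; apply: nO; case: (HG x Gx).
change (mu (th @^-1` (transl B (one_Omega B) @^-1` A)) = mu (th @^-1` A)).
rewrite -[RHS]inv; last exact: preimage_measurable.
have mT := measurable_transl B (one_Omega B).
apply: (eq_measure_off_negligible mu _ _ _ nG).
- by apply: preimage_measurable => //; exact: preimage_measurable.
- by apply: preimage_measurable => //; exact: preimage_measurable.
- by move=> x /contrapT Gx; rewrite /preimage/=; have [_ ->] := HG x Gx.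
Qed.

(** Intersecting [E] with the invariant full set [G] turns invariance on [G] into exact invariance
    without changing the measure. *)
Lemma ergodic_measure01 {d} {X : measurableType d} {R : realType} (mu : probability X R)
    (tau : X -> X) (G E : set X) :
  ergodic tau mu -> measurable G -> tau @^-1` G = G -> mu G = 1%E -> measurable E ->
  (forall x, G x -> E (tau x) <-> E x) -> mu E = 0%E \/ mu E = 1%E.
Proof.
move=> [_ erg] mG tG G1 mE tE.
have -> : mu E = mu (E `&` G).
  apply: (eq_measure_off_negligible mu (~` G)) => //.
  - exact: full_setC_negligible.
  - exact: measurableI.
  - by move=> x /contrapT Gx; split=> [|[]].
apply: erg; first exact: measurableI.
apply/seteqP; split=> x /= [Ex Gx].
  have Gx' : G x by rewrite -tG.
  by split=> //; apply/tE.
by split; [apply/tE|rewrite -[G]tG in Gx].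
Qed.

(** [rho] is the law of (phi (th x), u x), so invariance and ergodicity come from [mu]. The law of
    [th] is rotation-invariant, hence Haar, which makes the first marginal Mirsky. The system is
    left general to cover both the shift with [nu] and the rotation of Omega. *)
Lemma joining_of_factor {d} {X : measurableType d} {R : realType} (mu : probability X R)
    (tau : X -> X) (G : set X) (th : X -> seqN) (u : X -> seqZ) (B B' : set nat) :
  Bfree_basis R B' -> (forall w, OmegaSet B' w -> Xeta B (Defs.phi B' w)) ->
  measurable_fun setT tau -> ergodic tau mu ->
  measurable G -> tau @^-1` G = G -> mu G = 1%E ->
  measurable_fun setT th -> measurable_fun setT u ->
  (forall x, G x -> [/\ OmegaSet B' (th x), th (tau x) = transl B' (one_Omega B') (th x)
     & u (tau x) = Sshift (u x)]) ->
  exists rho : probability (seqZ * seqZ)%type R,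
    [/\ rho.-negligible (~` (Xeta B `*` setT)), ergodic Sshift2 rho,
      mirsky B' (pushforward rho fst) &
      forall A : set seqZ, measurable A ->
        pushforward rho Mmap A = mu ((fun x => Mmap (Defs.phi B' (th x), u x)) @^-1` A)].
Proof.
move=> HB' X' mtau erg mG tG G1 mth mu_ HG; have [B2 co _] := HB'.
have nG := full_setC_negligible mu G mG G1.
pose h x : seqZ * seqZ := (Defs.phi B' (th x), u x).
have mh : measurable_fun setT h.
  apply: measurable_fun_pair => //.
  by apply: (measurableT_comp (measurable_phi B')).
have hG x : G x -> h (tau x) = Sshift2 (h x).
  by move=> /HG[_ tht ut]; rewrite /h/Sshift2/= tht ut phi_transl_one.
pose H : {mfun X >-> (seqZ * seqZ)%type} := mfun_Sub (mem_set mh).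
pose rho : probability (seqZ * seqZ)%type R := distribution mu H.
have rhoE A : rho A = mu (h @^-1` A) by [].
have mS2 : measurable_fun setT Sshift2.
  by apply: measurable_fun_pair; apply: (measurableT_comp measurable_Sshift).
exists rho; split.
- exists (fst @^-1` (~` Xeta B)); split.
  + apply: preimage_measurable; first exact: measurable_fst.
    by apply: measurableC; exact: measurable_Xeta.
  + change (mu (h @^-1` (fst @^-1` (~` Xeta B))) = 0%E).
    apply/eqP; rewrite -measure_le0.
    have [M [mM M0 GM]] := nG; rewrite -M0 le_measure ?inE//.
      apply: preimage_measurable => //; apply: preimage_measurable; first exact: measurable_fst.
      by apply: measurableC; exact: measurable_Xeta.
    move=> x /= nX; apply: GM => Gx; apply: nX.
    by have [Ox _ _] := HG x Gx; exact: X'.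
  + by move=> [p q] /= nX Xp; apply: nX.
- split=> [A mA|A mA S2A].
    change (mu (h @^-1` (Sshift2 @^-1` A)) = mu (h @^-1` A)).
    rewrite -[RHS](proj1 erg); last exact: preimage_measurable.
    apply: (eq_measure_off_negligible mu _ _ _ nG).
    + by apply: preimage_measurable => //; exact: preimage_measurable.
    + by apply: preimage_measurable => //; exact: preimage_measurable.
    + by move=> x /contrapT Gx; rewrite /preimage/= hG.
  apply: (ergodic_measure01 mu tau G) => //; first exact: preimage_measurable.
  by move=> x Gx; rewrite /preimage/= hG// -[in X in _ <-> X]S2A.
- have HG' x : G x -> OmegaSet B' (th x) /\ th (tau x) = transl B' (one_Omega B') (th x).
    by move=> /HG[].
  have [P [PE nO invP]] := factor_to_Omega mu tau G th B' mtau (proj1 erg) mG G1 mth HG'.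
  exists P; split; first exact: invariant_haar.
  by move=> A mA; rewrite /pushforward PE.
- by move=> A mA.
Qed.

(** * Existence of Haar measure on Omega through Cantor series *)

Section HaarExists.
Context {R : realType}.
Notation RR := (measurableTypeR R).

Lemma measurable_truncn_scaled (q : nat) (m : nat) : (0 < q)%N ->
  measurable [set x : RR | Num.truncn (x * q%:R) = m].
Proof.
move=> q0; pose L n : set RR := [set` `]-oo, (n%:R / q%:R : R)[].
have mL n : measurable (L n) by exact: measurable_itv.
have LE n x : L n.+1 x <-> (Num.truncn (x * q%:R) <= n)%N.
  by rewrite /L/= in_itv/= ltr_pdivlMr ?ltr0n// truncn_le_nat.
case: m => [|m].
  rewrite (_ : [set _ | _] = L 1%N)//; apply/seteqP; split=> x.
    by move=> h; apply/LE; rewrite h.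
  by move/LE; rewrite leqn0 => /eqP.
rewrite (_ : [set _ | _] = L m.+2 `\` L m.+1); first exact: measurableD.
apply/seteqP; split=> x.
  by move=> h; split; [apply/LE; rewrite h|move/LE; rewrite h ltnn].
by move=> [/LE h1 h2]; apply/eqP; rewrite eqn_leq h1 ltnNge; apply/negP => /LE.
Qed.

Let I01 : set RR := [set` `[(0:R), 1[].

Let mI01 : measurable I01. Proof. exact: measurable_itv. Qed.

Lemma lebesgue_truncn_scaled (q : nat) (D : pred nat) : (0 < q)%N ->
  (lebesgue_measure : set RR -> \bar R) (I01 `&` [set x | D (Num.truncn (x * q%:R))]) =
  ((\sum_(m < q) D m)%:R / q%:R)%:E.
Proof.
move=> q0.
have q0R : 0 < q%:R :> R by rewrite ltr0n.
have E : I01 `&` [set x | D (Num.truncn (x * q%:R))] =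
    \big[setU/set0]_(m < q) (if D m then [set` `[(m%:R / q%:R : R), (m.+1%:R / q%:R : R)[] else set0).
  rewrite -(bigcup_mkord q (fun m => if D m then [set` `[(m%:R / q%:R : R), (m.+1%:R / q%:R : R)[] else set0)).
  apply/seteqP; split=> x.
    rewrite /I01/= in_itv/= => -[/andP[x0 x1] Dx].
    have xq0 : 0 <= x * q%:R by rewrite mulr_ge0.
    exists (Num.truncn (x * q%:R)).
      by rewrite /= truncn_lt_nat// gtr_pMl.
    by rewrite Dx/= in_itv/= ler_pdivrMr// ltr_pdivlMr// truncn_itv.
  move=> [m /= mq]; case: ifP => // Dm; rewrite /= in_itv/= ler_pdivrMr// ltr_pdivlMr// => mx.
  have x0 : 0 <= x by rewrite -(pmulr_lge0 _ q0R); case/andP: mx => + _; apply: le_trans.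
  split; last by rewrite (truncn_def mx).
  rewrite /I01/= in_itv/= x0/= -(ltr_pM2r q0R) mul1r.
  by case/andP: mx => _ /lt_le_trans; apply; rewrite ler_nat.
rewrite E measure_bigsetU_ord_cond//; last 2 first.
- by move=> i _; case: ifP.
- apply/trivIsetP => i j _ _ ij; apply/seteqP; split=> x //=.
  case: ifP => [_|_ []//]; case: ifP => [_|_ []//].
  rewrite /= !in_itv/= !ler_pdivrMr// !ltr_pdivlMr// => -[/truncn_def + /truncn_def].
  by move=> -> ij'; move: ij; rewrite -val_eqE/= ij' eqxx.
rewrite natr_sum mulr_suml -sumEFin; apply: eq_bigr => m _.
case: (D m) => /=; last by rewrite measure0 mul0r.
rewrite lebesgue_measure_itv/= lte_fin ltr_pM2r ?invr_gt0// ltr_nat ltnSn.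
by rewrite -EFinB -mulrBl -natrB// subSnn.
Qed.

Variable B : set nat.
Hypothesis B2 : forall b, B b -> (2 <= b)%N.

(** Radix 1 outside B forces the digit 0 there, as [OmegaSet] requires. *)
Let radix b : nat := if `[< B b >] then b else 1%N.
Let Q n : nat := (\prod_(i < n) radix i)%N.

Let radix0 b : (0 < radix b)%N.
Proof. by rewrite /radix; case: asboolP => // /B2; case: b. Qed.

Let Q0 n : (0 < Q n)%N. Proof. by apply: prodn_gt0 => i. Qed.

Let QS n : (Q n.+1 = Q n * radix n)%N. Proof. by rewrite /Q big_ord_recr. Qed.

(* Digits of [x] in the Cantor expansion with radices the elements of [B]. *)
Let digit (x : RR) : seqN := fun b => (Num.truncn (x * (Q b.+1)%:R) %% radix b)%N.

Let measurable_digit : measurable_fun setT digit.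
Proof.
apply: measurable_fun_seqN => b r.
have -> : [set x | digit x b = r] = \bigcup_(m in [set m | (m %% radix b)%N = r])
    [set x : RR | Num.truncn (x * (Q b.+1)%:R) = m].
  by apply/seteqP; split=> x /=; [exists (Num.truncn (x * (Q b.+1)%:R))|move=> [m mr e]; rewrite /digit e].
by apply: bigcup_measurable => m _; exact: measurable_truncn_scaled.
Qed.

(** The integer part of x Q_n thus encodes all digits before n, each further digit being a
    remainder. *)
Let lower_digits (x : R) n : 0 <= x ->
  (Num.truncn (x * (Q n)%:R) = Num.truncn (x * (Q n.+1)%:R) %/ radix n)%N.
Proof.
move=> x0; apply: truncn_def.
have y0 k : 0 <= x * k%:R by rewrite mulr_ge0.
have /andP[l1 l2] := truncn_itv (y0 (Q n.+1)).
set t := Num.truncn _ in l1 l2 *.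
have e0 : 0 < (radix n)%:R :> R by rewrite ltr0n.
rewrite -(ler_pM2r e0) -(ltr_pM2r e0) -mulrA -!natrM -QS.
rewrite (le_trans _ l1) ?ler_nat ?leq_divM//=.
by rewrite (lt_le_trans l2)// ler_nat ltn_ceil.
Qed.

(** Lebesgue measure on [0, 1), whose total mass is 1, packaged as a probability. *)
Let P0 : probability RR R :=
  mnormalize (mrestr (lebesgue_measure : {measure set RR -> \bar R}) mI01) (@dirac _ RR (0 : R) R).

Let P0E A : P0 A = lebesgue_measure (A `&` I01).
Proof.
rewrite /P0/= /mnormalize/=.
have -> : mrestr lebesgue_measure mI01 setT = 1%E.
  rewrite /mrestr setTI /I01 lebesgue_measure_itv/= lte_fin ltr01.
  by rewrite oppr0 adde0.
by rewrite onee_eq0/= invr1 mule1.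
Qed.

Let DIG : {mfun RR >-> seqN} := mfun_Sub (mem_set measurable_digit).
Let P : probability seqN R := distribution P0 DIG.

Let P_cylinder n A : P (cylinder n A) = (\prod_(i < n) coord_weight B A i)%:E.
Proof.
change (P0 (digit @^-1` cylinder n A) = (\prod_(i < n) coord_weight B A i)%:E).
(* [D k] turns the condition on the first k digits of x into one on the integer part of x Q_k, which
   is uniform on Q_k values. *)
pose fix D k : pred nat := match k with
  | 0 => predT
  | k'.+1 => fun m => D k' (m %/ radix k')%N && A k' (m %% radix k')%N end.
have DE k x : 0 <= x -> (cylinder k A (digit x)) <-> D k (Num.truncn (x * (Q k)%:R)).
  move=> x0; elim: k => [//|k IH]; rewrite /= -lower_digits//; split.
    move=> h; apply/andP; split; last exact: h.
    by apply/IH => i ik; apply: h; exact: ltnW.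
  move=> /andP[/IH h h'] i; rewrite ltnS leq_eqVlt => /predU1P[->//|].
  exact: h.
have -> : P0 (digit @^-1` cylinder n A) = ((\sum_(m < Q n) D n m)%:R / (Q n)%:R)%:E.
  rewrite P0E -lebesgue_truncn_scaled// setIC; congr (lebesgue_measure _).
  by apply/seteqP; split=> x /=; rewrite /I01/= in_itv/= => -[/andP[x0 x1]] /DE h;
    (split; first exact/andP); apply: h.
congr (_%:E); elim: n {DE} => [|n IH].
  by rewrite /Q !big_ord0 big_ord_recr big_ord0/= divr1.
rewrite big_ord_recr/= -IH QS.
(* Division by [radix n] splits the index into the earlier digits and the digit at n, and the count
   factors. *)
have -> : (\sum_(m < Q n * radix n) D n.+1 m = (\sum_(m < Q n) D n m) * (\sum_(r < radix n) A n r))%N.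
  rewrite -(big_mkord predT (fun m => nat_of_bool (D n.+1 m))) big_nat_mul big_mkord big_distrl/=.
  apply: eq_bigr => m _; rewrite big_distrr/=.
  rewrite -{1}[(m * radix n)%N]add0n mulSn big_addn addnK big_mkord.
  apply: eq_bigr => r _; rewrite (addnC (r : nat)) divnMDl// modnMDl divn_small// addn0 modn_small//.
  by case: (D n m); case: (A n r).
rewrite /coord_weight /radix; case: asboolP => Bn.
  by rewrite !natrM invfM mulrACA.
by rewrite big_ord_recr big_ord0 !muln1 natrM mulrAC.
Qed.

(** Adding 1 permutes the residues in each coordinate, so it preserves the measure of every
    cylinder, and cylinders determine the measure. *)
Lemma haar_exists : exists P : probability seqN R,
  P.-negligible (~` OmegaSet B) /\ Defs.invariant (transl B (one_Omega B)) P.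
Proof.
exists P; split.
  exists (~` OmegaSet B); split=> //; first by apply: measurableC; exact: measurable_OmegaSet.
  change (P0 (digit @^-1` (~` OmegaSet B)) = 0%E).
  rewrite (_ : _ @^-1` _ = set0) ?measure0//; apply/seteqP; split=> x //=; apply => b.
  rewrite /digit /radix; case: asboolP => Bb; split=> //.
    by move=> _; rewrite ltn_mod; case: b Bb {x} => // /B2.
  by rewrite modn1.
have mT := measurable_transl B (one_Omega B).
pose T : {mfun seqN >-> seqN} := mfun_Sub (mem_set mT).
apply: (seqN_measure_unique (distribution P T) P); last first.
  exact: le_lt_trans (probability_le1 (distribution P T) measurableT) (ltry _).
move=> n A.
change (P (transl B (one_Omega B) @^-1` cylinder n A) = P (cylinder n A)).
pose A' i : pred nat := fun r => if `[< B i >] then A i ((r + 1) %% i)%N else A i 0%N.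
have -> : transl B (one_Omega B) @^-1` cylinder n A = cylinder n A'.
  apply/seteqP; split=> x h i lin; move: (h i lin); rewrite /A' /transl /one_Omega;
    by case: asboolP.
rewrite !P_cylinder; congr (_%:E); apply: eq_bigr => i _.
rewrite /coord_weight /A'; case: asboolP => // Bi.
congr (_%:R / _); rewrite [RHS](reindex_inj (@ordS_inj i)).
by apply: eq_bigr => r _; rewrite /= addn1.
Qed.

End HaarExists.

(** * The rotation orbit of the missed residue classes *)

Lemma iter_mul_id {T : Type} (f : T -> T) (x : T) (m q : nat) :
  iter m f x = x -> iter (q * m) f x = x.
Proof. by move=> fx; elim: q => [//|q IH]; rewrite mulSn iterD IH. Qed.

Lemma order_dvd {T : finType} (f : T -> T) (x : T) (m : nat) :
  injective f -> iter m f x = x -> (order f x %| m)%N.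
Proof.
move=> injf; rewrite {1}(divn_eq m (order f x)) addnC iterD.
rewrite iter_mul_id; last exact: iter_order.
move=> h; rewrite /dvdn.
have r_lt : (m %% order f x < order f x)%N by rewrite ltn_mod order_gt0.
by rewrite -(findex_iter r_lt) h findex0.
Qed.

Lemma findex_step {T : finType} (f : T -> T) (x y : T) :
  injective f -> fconnect f x y ->
  findex f x (f y) = ((findex f x y + 1) %% order f x)%N.
Proof.
move=> injf xy; have jlt := findex_max xy.
rewrite -{1}(iter_findex xy) -iterS addn1.
move: jlt; rewrite leq_eqVlt => /predU1P[->|jlt].
  by rewrite iter_order// findex0 modnn.
by rewrite findex_iter// modn_small.
Qed.

Section ResidueFactor.
Context {R : realType} (nu : probability seqZ R).
Hypothesis nu_erg : ergodic Sshift nu.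
Variable b : nat.
Hypothesis b0 : (0 < b)%N.
Hypothesis nu_missing : nu.-negligible
  [set y | ~ exists r : nat, (r < b)%N /\ forall n : int, (b%:Z %| r%:Z + n)%Z -> ~~ y n].

Let F := {ffun 'I_b -> bool}.

(** The pattern of residue classes modulo b missed by the support of y. *)
Let code (y : seqZ) : F :=
  [ffun i : 'I_b => `[< forall n : int, (b%:Z %| n - (i : nat)%:Z)%Z -> ~~ y n >]].

Let rot (p : F) : F := [ffun i => p (ordS i)].

Let code_shift y : code (Sshift y) = rot (code y).
Proof.
apply/ffunP => i; rewrite !ffunE; apply: asbool_equiv_eq.
have E (n : int) : (b%:Z %| n + 1 - (ordS i : nat)%:Z)%Z = (b%:Z %| n - (i : nat)%:Z)%Z.
  rewrite /= -!eqz_mod_dvd -(eqz_modDr 1 n).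
  by rewrite (_ : (i : nat)%:Z + 1 = i.+1%:Z); [rewrite -modz_nat modz_mod|rewrite -addn1 PoszD].
split=> h n.
  by rewrite -(subrK 1 n) E; exact: h.
by rewrite -E; exact: h.
Qed.

Let iter_rot j p i : iter j rot p i = p (iter j (@ordS b) i).
Proof. by elim: j i => [//|j IH] i; rewrite iterS ffunE IH -iterSr. Qed.

Let val_iter_ordS j (i : 'I_b) : (iter j (@ordS b) i = (i + j) %% b :> nat)%N.
Proof.
elim: j => [|j IH]; first by rewrite addn0 modn_small.
by rewrite iterS /= IH -[in LHS]addn1 modnDml -addnA addn1.
Qed.

Let iter_rot_b p : iter b rot p = p.
Proof.
apply/ffunP => i; rewrite iter_rot; congr (p _); apply: val_inj => /=.
by rewrite val_iter_ordS modnDr modn_small.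
Qed.

Let rot_inj : injective rot.
Proof.
case: (b) b0 iter_rot_b => // b' _ h p q pq.
by rewrite -(h p) -(h q) !iterSr pq.
Qed.

Let measurable_code (D : set F) : measurable (code @^-1` D).
Proof.
have -> : code @^-1` D = \bigcup_(p in D) (code @^-1` [set p]).
  by apply/seteqP; split=> y /=; [move=> Dy; exists (code y)|move=> [p Dp ->]].
apply: fin_bigcup_measurable; first exact: finite_finset.
move=> p _.
have -> : code @^-1` [set p] = \bigcap_(i in [set` enum 'I_b]) [set y | code y i = p i].
  apply/seteqP; split=> y /=; first by move=> e i _ /=; rewrite -e.
  by move=> h; apply/ffunP => i; apply: h; rewrite /= mem_enum.
apply: fin_bigcap_measurable => // i _.
have mi : measurable [set y | code y i].
  have -> : [set y | code y i] = \bigcap_(n : int)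
      [set y : seqZ | (b%:Z %| n - (i : nat)%:Z)%Z -> ~~ y n].
    apply/seteqP; split=> y; rewrite /= ffunE; first by move/asboolP => h n _; exact: h.
    by move=> h; apply/asboolP => n; exact: h.
  apply: countable_bigcapT_measurable => // n.
  exact: (measurable_coordZ n [set t | (b%:Z %| n - (i : nat)%:Z)%Z -> ~~ t]).
case: (p i).
  by rewrite (_ : [set _ | _] = [set y | code y i]).
rewrite (_ : [set _ | _] = ~` [set y | code y i]); first exact: measurableC.
by apply/seteqP; split=> y /=; [move=> e; rewrite e|case: (code y i)].
Qed.

Let i0 : 'I_b := Ordinal b0.

Let orb (p : F) : set seqZ := code @^-1` [set q | fconnect rot p q].

Let orb_shift p : Sshift @^-1` orb p = orb p.
Proof.
by apply/seteqP; split=> y; rewrite /orb/= /preimage/= code_shift -same_fconnect1_r.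
Qed.

(* The orbit of the missed-class pattern under rotation is almost surely constant. *)
Let exists_orb : exists p : F, p i0 /\ nu (orb p) = 1%E.
Proof.
apply: contrapT => nex.
have nu0 (p : F) : p i0 -> nu (orb p) = 0%E.
  move=> pi0; have [//|orb1] := proj2 nu_erg _ (measurable_code _) (orb_shift p).
  by case: nex; exists p.
have nU : nu.-negligible (\big[setU/set0]_(p <- enum F | (p : F) i0) orb p).
  apply: (big_ind (fun A => nu.-negligible A)).
  - exact: negligible_set0.
  - by move=> A A'; exact: negligibleU.
  - by move=> p pi0; exists (orb p); split; [exact: measurable_code|exact: nu0|].
have : nu.-negligible setT.
  apply: negligibleS (negligibleU nu_missing nU) => y _.
  have [[r [rb rP]]|] := pselect (exists r : nat, (r < b)%N /\ forall n : int, (b%:Z %| r%:Z + n)%Z -> ~~ y n); last by left.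
  right; rewrite -bigcup_seq_cond.
  pose i : 'I_b := Ordinal (ltn_pmod (b - r) b0).
  have ci : code y i.
    rewrite ffunE; apply/asboolP => n; rewrite -eqz_mod_dvd /= -modz_nat modz_mod.
    rewrite -subzn ?(ltnW rb)// => h; apply: rP.
    move: h; rewrite eqz_mod_dvd => h.
    rewrite (_ : _ + n = n - (b%:Z - r%:Z) + b%:Z); last by ring.
    by rewrite rpredD//; exact: dvdzz.
  (* Rotating the pattern by a missed class i brings that class to position 0, giving an orbit
     representative [p] with [p i0]. *)
  exists (iter i rot (code y)).
    rewrite /= mem_enum/= iter_rot.
    suff -> : iter i (@ordS b) i0 = i by [].
    by apply: val_inj => /=; rewrite val_iter_ordS add0n modn_mod.
  rewrite /orb/= fconnect_sym//; exact: fconnect_iter.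
move=> /(negligibleP nu measurableT) nuT0; have := probability_setT nu.
by move/(etrans (esym nuT0))/esym/eqP; rewrite onee_eq0.
Qed.

(** d is the size of the almost sure orbit, and [th y] the position of [code y] in it, counted from
    a pattern [p] missing the class 0. As [p] has period d, the pattern at position j misses every
    class i with d dividing i + j. *)
Lemma residue_factor : exists (d : nat) (th : seqZ -> nat) (G : set seqZ),
  [/\ (d %| b)%N, (forall D, measurable (th @^-1` D)),
    [/\ measurable G, Sshift @^-1` G = G & nu G = 1%E] &
    forall y, G y -> [/\ (th y < d)%N, th (Sshift y) = ((th y + 1) %% d)%N &
      forall n : int, (d%:Z %| (th y)%:Z + n)%Z -> ~~ y n]].
Proof.
have [p [pi0 orb1]] := exists_orb.
have ob : (order rot p %| b)%N by apply: order_dvd.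
exists (order rot p), (fun y => findex rot p (code y)), (orb p); split=> //.
- by move=> D; exact: (measurable_code [set q | D (findex rot p q)]).
- by split=> //; exact: measurable_code.
move=> y py; split.
- exact: findex_max.
- by rewrite code_shift; exact: findex_step.
- move=> n dn.
  have nb : (`|(n %% b%:Z)%Z|%N < b)%N.
    by rewrite -ltz_nat gez0_abs ?modz_ge0 ?gt_eqF// ltz_pmod.
  pose i : 'I_b := Ordinal nb.
  have iE : (i : nat)%:Z = (n %% b%:Z)%Z by rewrite /= gez0_abs// modz_ge0// gt_eqF.
  suff : code y i.
    rewrite ffunE => /asboolP; apply.
    by rewrite iE -eqz_mod_dvd modz_mod.
  set j := findex rot p (code y) in dn *.
  have -> : code y = iter j rot p by rewrite /j iter_findex.
  have dij : (order rot p %| i + j)%N.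
    rewrite -[(_ %| _)%N]/((order rot p)%:Z %| (i + j)%N%:Z)%Z PoszD iE addrC.
    apply/dvdz_mod0P; rewrite -modzDmr.
    have -> : ((n %% b%:Z)%Z %% (order rot p)%:Z)%Z = (n %% (order rot p)%:Z)%Z.
      apply/eqP; rewrite eqz_mod_dvd.
      rewrite (_ : _ - n = - ((n %/ b%:Z)%Z * b%:Z)); last first.
        by rewrite [X in _ - X](divz_eq n b%:Z); ring.
      by rewrite rpredN dvdz_mull// dvdzE.
    by rewrite modzDmr; exact/dvdz_mod0P.
  have [q qE] : exists q, (i + j = q * order rot p)%N by exact/dvdnP.
  rewrite iter_rot.
  have -> : iter j (@ordS b) i = iter (q * order rot p) (@ordS b) i0.
    by apply: val_inj => /=; rewrite !val_iter_ordS add0n qE.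
  by rewrite -iter_rot iter_mul_id// iter_order.
Qed.

End ResidueFactor.

(** * The point mass at 0 *)

Lemma seqZ_all_false_full {R : realType} (nu : probability seqZ R) :
  Defs.invariant Sshift nu -> nu [set y | y 0] = 0%E ->
  nu.-negligible (~` [set (fun=> false) : seqZ]).
Proof.
move=> inv nu0.
have m1 n : measurable [set y : seqZ | y n] by exact: (measurable_coordZ n [set true]).
have step n : nu [set y | y (n + 1)] = nu [set y | y n].
  exact: (inv [set y : seqZ | y n] (m1 n)).
have nun n : nu [set y | y n] = 0%E.
  elim: n => [//|n IH|n IH].
    by rewrite (_ : n.+1%:Z = n%:Z + 1) ?step// -addn1 PoszD.
  by rewrite -step (_ : - n.+1%:Z + 1 = - n%:Z)//; lia.
apply: (@negligibleS _ _ _ nu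
    (\bigcup_k ([set y : seqZ | y k%:Z] `|` [set y : seqZ | y (- k%:Z)]))).
  move=> y y0; have [n yn] : exists n, y n.
    apply: contrapT => ny; apply: y0; apply/funext => n.
    by apply/negbTE/negP => yn; apply: ny; exists n.
  exists `|n|%N => //=; have [n0|/ltW n0] := leP 0 n.
    by left; rewrite /= gez0_abs.
  by right; rewrite /= lez0_abs// opprK.
apply: negligible_bigcup => k.
by apply: negligibleU; apply/(negligibleP nu (m1 _)); exact: nun.
Qed.

(** The general construction is applied to the rotation of Omega with a Haar measure, the second
    coordinate being constantly 0; the product sequence is then 0. *)
Lemma trivial_joining {R : realType} (B : set nat) (nu : probability seqZ R) :
  Bfree_basis R B -> nu.-negligible (~` [set (fun=> false) : seqZ]) ->
  exists rho : probability (seqZ * seqZ)%type R,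
    [/\ rho.-negligible (~` (Xeta B `*` setT)), ergodic Sshift2 rho,
      mirsky B (pushforward rho fst) &
      forall A : set seqZ, measurable A -> pushforward rho Mmap A = nu A].
Proof.
move=> HB [N [mN N0 NN]]; have [B2 co _] := HB.
have [P [nO invP]] := @haar_exists R B B2.
have mu0 : measurable_fun setT ((fun=> (fun=> false) : seqZ) : seqN -> seqZ).
  exact: measurable_cst.
have [rho [r1 r2 r3 r4]] := joining_of_factor P (transl B (one_Omega B)) setT (reduce B)
   (fun=> (fun=> false) : seqZ) B B HB (fun w _ => Xeta_phi B w HB)
   (measurable_transl _ _) (invariant_ergodic B P B2 co nO invP)
   measurableT (preimage_setT _) (probability_setT P) (measurable_transl _ _) mu0
   (fun x _ => And3 (transl_OmegaSet B _ x B2) (translC B _ _ x) erefl).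
exists rho; split=> // A mA; rewrite r4//.
have M0 x : Mmap (x, (fun=> false) : seqZ) = (fun=> false) :> seqZ.
  by apply/funext => n; rewrite /Mmap andbF.
have [A0|nA0] := pselect (A (fun=> false)).
  rewrite (_ : _ @^-1` A = setT); last first.
    by apply/seteqP; split=> // x _; rewrite /preimage/= M0.
  rewrite probability_setT; apply/esym.
  rewrite -[LHS](eq_measure_off_negligible nu N setT A) ?probability_setT//.
    by exists N; split.
  move=> y nNy; split=> // _; suff -> : y = (fun=> false) by [].
  by apply: contrapT => h; apply: nNy; exact: NN.
rewrite (_ : _ @^-1` A = set0); last first.
  by apply/seteqP; split=> // x; rewrite /preimage/= M0.
rewrite measure0; apply/esym/eqP; rewrite -measure_le0 -N0 le_measure ?inE//.
by move=> y Ay; apply: NN => y0; apply: nA0; rewrite -y0.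
Qed.

(** * Convergence of the reciprocal sum, and inclusion of subshifts *)

(* [(1 - x) (1 + x) <= 1] factor by factor, and [\prod (1 + x) >= 1 + \sum x]. *)
Lemma sum_le_of_prod_ge {R : realType} (n : nat) (P : pred nat) (x : nat -> R) (c : R) :
  (forall i, P i -> 0 <= x i <= 1) -> 0 < c ->
  c <= \prod_(i < n | P i) (1 - x i) -> \sum_(i < n | P i) x i <= c^-1.
Proof.
move=> x01 c0 cP.
have H1 : 1 + \sum_(i < n | P i) x i <= \prod_(i < n | P i) (1 + x i).
  suff [] : 0 <= \sum_(i < n | P i) x i /\
      1 + \sum_(i < n | P i) x i <= \prod_(i < n | P i) (1 + x i) by [].
  apply: (big_rec2 (fun s p => 0 <= s /\ 1 + s <= p :> R)); first by rewrite addr0.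
  move=> i s p Pi [s0 h]; have /andP[xi0 _] := x01 i Pi.
  have p1 : 1 <= p by apply: le_trans h; rewrite lerDl.
  by nra.
have H2 : \prod_(i < n | P i) (1 - x i) * \prod_(i < n | P i) (1 + x i) <= 1.
  rewrite -big_split/=; apply: (proj2 (A := 0 <= _)).
  apply: (big_ind (fun p => 0 <= p /\ p <= 1)) => [//|p q [p0 p1] [q0 q1]|i Pi].
    by split; nra.
  by have /andP[xi0 xi1] := x01 i Pi; split; nra.
have p0 : 0 < \prod_(i < n | P i) (1 + x i).
  by apply: prodr_gt0 => i Pi; have /andP[xi0 _] := x01 i Pi; rewrite ltr_pwDl.
have : c * \prod_(i < n | P i) (1 + x i) <= 1.
  by apply: le_trans H2; rewrite ler_pM2r.
rewrite mulrC -ler_pdivlMr// div1r; apply: le_trans; apply: le_trans H1.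
by rewrite lerDr.
Qed.

Lemma Bfree_of_prod_ge {R : realType} (B : set nat) (c : R) :
  (forall b, B b -> (2 <= b)%N) ->
  (forall b c, B b -> B c -> b <> c -> coprime b c) -> 0 < c ->
  (forall n, c <= \prod_(i < n | `[< B i >]) (1 - i%:R^-1)) -> Bfree_basis R B.
Proof.
move=> B2 co c0 cP; split=> //.
apply: (@le_lt_trans _ _ (c^-1)%:E); last exact: ltry.
apply: lime_le.
  by apply: is_cvg_nneseries => n _ _; rewrite lee_fin invr_ge0.
apply: nearW => n; rewrite sumEFin lee_fin big_mkord.
rewrite (eq_bigl (fun i : 'I_n => `[< B i >])); last first.
  by move=> i; apply/idP/asboolP; rewrite inE.
apply: (sum_le_of_prod_ge n (fun i => `[< B i >]) (fun i => i%:R^-1)) => // i /asboolP Bi.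
rewrite invr_ge0 ler0n/= invf_le1 ?ler1n ?ltr0n; by apply: leq_trans (B2 i Bi).
Qed.

Lemma coord_weight_neq0 {R : realType} (B : set nat) i : (forall b, B b -> (2 <= b)%N) ->
  coord_weight B (fun i => [pred r | `[< B i >] ==> (r != 0%N)]) i =
  (if `[< B i >] then 1 - i%:R^-1 else 1) :> R.
Proof.
move=> B2; rewrite /coord_weight; case: asboolP => // Bi.
case: i Bi => [/B2//|i Bi].
rewrite big_ord_recl/= add0n.
under eq_bigr do rewrite /= /bump/=.
rewrite sum1_card card_ord -[in LHS](addrK 1 i%:R) natr1 mulrBl divff ?pnatr_eq0//.
by rewrite div1r.
Qed.

(** A class missed modulo [d b] contains a class missed modulo b, so y lies below a point [phi B r];
    for infinite B this suffices. *)
Lemma Xeta_sub_divisors {R : realType} (B : set nat) (d : nat -> nat) :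
  Bfree_basis R B -> Bfree_basis R (d @` B) ->
  (forall b, B b -> (d b %| b)%N) -> infinite_set B -> Xeta (d @` B) `<=` Xeta B.
Proof.
move=> HB HB' db infB y Xy; have [B2' _ _] := HB'.
have [r rP] : {r : nat -> nat & forall b, B b ->
    forall n : int, ((d b)%:Z %| (r b)%:Z + n)%Z -> ~~ y n}.
  apply: (@choice _ _ (fun b s => B b -> forall n : int, ((d b)%:Z %| s%:Z + n)%Z -> ~~ y n)).
  move=> b; have [Bb|] := pselect (B b); last by exists 0%N.
  have Bd : (d @` B) (d b) by exists b.
  have [|s [_ sP]] := Xeta_missing _ _ _ Xy Bd; first by apply: leq_trans (B2' _ Bd).
  by exists s.
apply: (Xeta_infinite B y r HB infB) => n yn; apply/asboolP => b Bb bd.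
have /negP := rP b Bb n (dvdz_trans (db b Bb : (d b)%:Z %| b%:Z)%Z bd).
by rewrite yn.
Qed.

(** * Assembly of the residue factors *)

Theorem theorem2 (R : realType) (B : set nat) (HB : Bfree_basis R B)
  (nu : probability seqZ R)
  (nu_on : nu.-negligible (~` Xeta B))
  (nu_erg : ergodic Sshift nu) :
  exists B' : set nat,
    [/\ Bfree_basis R B', Xeta B' `<=` Xeta B &
    exists rho : probability (seqZ * seqZ)%type R,
      [/\ rho.-negligible (~` (Xeta B `*` setT)),
          ergodic Sshift2 rho,
          mirsky B' (pushforward rho fst) &
          forall A : set seqZ, measurable A -> pushforward rho Mmap A = nu A]].
Proof.
have [nu00|nu0] := eqVneq (nu [set y : seqZ | y 0]) 0%E.
  exists B; split=> //; apply: trivial_joining => //.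
  by apply: seqZ_all_false_full => //; case: nu_erg.
have [B2 co _] := HB.
have m0 : measurable [set y : seqZ | y 0] by exact: (measurable_coordZ 0 [set true]).
have loc b : exists t : nat * (seqZ -> nat) * set seqZ, B b ->
  [/\ (t.1.1 %| b)%N, (forall D, measurable (t.1.2 @^-1` D)),
    [/\ measurable t.2, Sshift @^-1` t.2 = t.2 & nu t.2 = 1%E] &
    forall y, t.2 y -> [/\ (t.1.2 y < t.1.1)%N, t.1.2 (Sshift y) = ((t.1.2 y + 1) %% t.1.1)%N &
      forall n : int, (t.1.1%:Z %| (t.1.2 y)%:Z + n)%Z -> ~~ y n]].
  have [Bb|] := pselect (B b); last by exists (0%N, (fun=> 0%N), setT).
  have b0 : (0 < b)%N by apply: leq_trans (B2 b Bb).
  have [|d [th [G H]]] := residue_factor nu nu_erg b b0; last by exists (d, th, G).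
  apply: negligibleS nu_on => y ny Xy; apply: ny.
  exact: Xeta_missing Xy Bb b0.
have [t tP] := choice loc.
pose d b := (t b).1.1; pose th b := (t b).1.2; pose Gs b := (t b).2.
have dvd b : B b -> (d b %| b)%N by move=> /tP[].
have mth b D : B b -> measurable (th b @^-1` D) by move=> /tP[_ + _ _]; exact.
pose G := \bigcap_(b in B) Gs b.
have mG : measurable G.
  by apply: bigcap_measurableType => b /tP[_ _ []].
have SG : Sshift @^-1` G = G.
  rewrite /G preimage_bigcap; apply: eq_bigcapr => b /tP[_ _ []].
  by [].
have G1 : nu G = 1%E.
  have : nu (~` G) = 0%E.
    apply/(negligibleP nu (measurableC mG)).
    rewrite /G setC_bigcap bigcup_mkcond; apply: negligible_bigcup => b.
    case: ifPn => [|_]; last exact: negligible_set0.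
    by rewrite inE => /tP[_ _ [mGb _ Gb1] _]; exact: full_setC_negligible.
  by move=> G0; rewrite -[G]setCK probability_setC ?G0 ?sube0//; exact: measurableC.
have GP b y : B b -> G y -> [/\ (th b y < d b)%N, th b (Sshift y) = ((th b y + 1) %% d b)%N &
      forall n : int, ((d b)%:Z %| (th b y)%:Z + n)%Z -> ~~ y n].
  by move=> Bb Gy; have [_ _ _] := tP b Bb; apply; exact: Gy.
have nG := full_setC_negligible nu G mG G1.
(* Such a point exists since y(0) = 1 has positive measure. It excludes [d b = 1], and it settles
   the case of finite B. *)
have [y1 [Gy1 Xy1 y10]] : exists y, [/\ G y, Xeta B y & y 0].
  apply: contrapT => ny; move/eqP: nu0; apply; rewrite -(measure0 nu).
  apply: (eq_measure_off_negligible nu _ _ _ (negligibleU nG nu_on)) => // y.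
  rewrite -setCI => /contrapT[Gy Xy]; split=> // y0.
  by apply: ny; exists y.
pose B' := d @` B.
have d2 b : B b -> (2 <= d b)%N.
  move=> Bb; have [thd _ mis] := GP b y1 Bb Gy1.
  rewrite ltn_neqAle (leq_ltn_trans _ thd)// andbT; apply/eqP => d1.
  have : ~~ y1 0 by apply: mis; rewrite -d1 dvdzE dvd1n.
  by rewrite y10.
have B2' b : B' b -> (2 <= b)%N by move=> [c Bc <-]; exact: d2.
have co' b c : B' b -> B' c -> b <> c -> coprime b c.
  move=> [b1 Bb1 <-] [c1 Bc1 <-] bc.
  apply: (coprime_dvdl (dvd _ Bb1)); apply: (coprime_dvdr (dvd _ Bc1)).
  by apply: co => // bc1; apply: bc; rewrite bc1.
(* A section of [d], choosing for each modulus of [B'] the element of B whose factor is used. *)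
have [g gP] : {g : nat -> nat & forall e, B' e -> B (g e) /\ d (g e) = e}.
  apply: (@choice _ _ (fun e b => B' e -> B b /\ d b = e)) => e.
  by have [[b Bb be]|] := pselect (B' e); [exists b|exists 0%N].
pose theta (y : seqZ) : seqN := fun e => if `[< B' e >] then th (g e) y else 0%N.
have mtheta : measurable_fun setT theta.
  apply: measurable_fun_seqN => e r; rewrite /theta; case: asboolP => [/gP[Bg _]|_].
    exact: (mth _ [set r] Bg).
  case: r => [|r]; first by rewrite (_ : [set _ | _] = setT)//; apply/seteqP; split.
  by rewrite (_ : [set _ | _] = set0)//; apply/seteqP; split.
have thetaG y : G y -> OmegaSet B' (theta y) /\
    theta (Sshift y) = transl B' (one_Omega B') (theta y).
  move=> Gy; split=> [e|].
    rewrite /theta; case: asboolP => // B'e; split=> // _.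
    have [Bg {2}<-] := gP e B'e.
    by have [] := GP _ y Bg Gy.
  apply/funext => e; rewrite /theta /transl /one_Omega; case: asboolP => // B'e.
  have [Bg ge] := gP e B'e.
  by have [_ -> _] := GP _ y Bg Gy; rewrite ge.
(* Each coordinate of [theta y] names a class on which y vanishes. This domination yields both the
   density bound below and the identity M(phi(theta y), y) = y. *)
have y_phi y n : G y -> y n -> Defs.phi B' (theta y) n.
  move=> Gy yn; apply/asboolP => e B'e; rewrite /theta asboolT// => dn.
  have [Bg ge] := gP e B'e; have [_ _ /(_ n)] := GP _ y Bg Gy.
  by rewrite ge yn => /(_ dn).
have mSshift := measurable_Sshift.
have HB' : Bfree_basis R B'.
  have [P [PE nO invP]] := factor_to_Omega nu Sshift G theta B' mSshift (proj1 nu_erg)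
    mG G1 mtheta thetaG.
  have finP := fineK (fin_num_measure nu _ m0).
  apply: (Bfree_of_prod_ge B' (fine (nu [set y : seqZ | y 0]))) => //.
    by rewrite -lte_fin finP measure_gt0.
  move=> n; rewrite -lee_fin finP.
  (* By domination, y(0) = 1 forces [theta y] to be nonzero at every modulus of [B']; for those
     below n this event has measure the product of 1 - 1/i. *)
  pose A i : pred nat := [pred r | `[< B' i >] ==> (r != 0%N)].
  have := measure_cylinder B' P setT n A B2' co' nO invP measurableT (preimage_setT _).
  rewrite setTI probability_setT mul1e.
  under eq_bigr do rewrite coord_weight_neq0//.
  rewrite -big_mkcond => <-; rewrite PE.
  have mC : measurable (theta @^-1` cylinder n A).
    by apply: preimage_measurable => //; exact: measurable_cylinder.
  apply: (@le_trans _ _ (nu ([set y : seqZ | y 0] `&` G))).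
    rewrite le_eqVlt; apply/orP; left; apply/eqP.
    apply: (eq_measure_off_negligible nu _ _ _ nG) => //; first exact: measurableI.
    by move=> y /contrapT Gy; split=> [|[]].
  rewrite le_measure ?inE//; first exact: measurableI.
  move=> y [y0 Gy] i _; apply/implyP => /asboolP B'i; apply/eqP => th0.
  by have /asboolP/(_ i B'i) := y_phi y 0 Gy y0; rewrite th0; apply; rewrite dvdz0.
have sub : Xeta B' `<=` Xeta B.
  have [finB|infB] := pselect (finite_set B); last first.
    exact: (Xeta_sub_divisors B d HB HB' dvd infB).
  suff -> : B' = B by [].
  (* Both [th b y1] and [th b y1 + d b] give missed classes modulo b, so uniqueness makes b divide
     [d b]. *)
  have dE b : B b -> d b = b.
    move=> Bb; have [_ _ mis] := GP b y1 Bb Gy1.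
    have mis' n : (b%:Z %| (th b y1)%:Z + n)%Z -> ~~ y1 n.
      by move=> bn; apply: mis; apply: dvdz_trans bn; exact: dvd.
    have mis2 n : (b%:Z %| (th b y1 + d b)%N%:Z + n)%Z -> ~~ y1 n.
      move=> bn; apply: mis; have /(dvdz_trans (dvd b Bb : (d b)%:Z %| b%:Z)%Z) := bn.
      by rewrite PoszD addrAC => h; rewrite -(rpredDr _ (dvdzz (d b))).
    have := Xeta_finite_missing_unique B y1 b B2 co finB Xy1 Bb _ _ mis' mis2.
    rewrite -{1}(addn0 (th b y1)) => /eqP; rewrite eqn_modDl mod0n => /eqP/esym/eqP bd.
    by apply/eqP; rewrite eqn_dvd dvd.
  by apply/seteqP; split=> [_ [b Bb <-]|b Bb]; [rewrite dE|exists b => //; exact: dE].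
exists B'; split=> //.
have HG x : G x -> [/\ OmegaSet B' (theta x),
    theta (Sshift x) = transl B' (one_Omega B') (theta x) & Sshift x = Sshift x].
  by move=> /thetaG[].
have [rho [r1 r2 r3 r4]] := joining_of_factor nu Sshift G theta id B B' HB'
  (fun w _ => sub _ (Xeta_phi B' w HB')) mSshift nu_erg mG SG G1 mtheta
  (@measurable_id _ _ _) HG.
exists rho; split=> // A mA; rewrite r4//.
apply: (eq_measure_off_negligible nu _ _ _ nG) => //.
  apply: preimage_measurable => //; apply: (measurableT_comp measurable_Mmap).
  apply: measurable_fun_pair; last exact: measurable_id.
  exact: (measurableT_comp (measurable_phi B')).
move=> y /contrapT Gy; rewrite /preimage/=.
suff -> : Mmap (Defs.phi B' (theta y), y) = y by [].
apply/funext => n; rewrite /Mmap/=; case yn : (y n); last by rewrite andbF.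
by rewrite (y_phi y n Gy yn).
Qed.
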